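(* For all integers $n\ge1$, the Hilbert series $\sum_{d\ge0}\dim_{\mathbb F_q}\bigl(\mathbb F_q[x_1,\ldots,x_n]_{\mathrm B_n}\bigr)_d\,t^d$ of the cofixed space of $\mathrm B_n$ acting on $\mathbb F_q[x_1,\ldots,x_n]$ equals $$\sum_{\beta\in\{0,1\}^n}\ \frac{t^{\sum_{i=1}^n(q^{B_i}-1)}}{\prod_{i:\ \beta_i=1}\bigl(1-t^{q^{B_i}-q^{B_i-1}}\bigr)},$$ where for $\beta=(\beta_1,\ldots,\beta_n)$ we write $B_i=\beta_1+\cdots+\beta_i$.
   Context: Let $q$ be a power of a prime and $\mathbb F_q$ the field with $q$ elements. $\mathrm{GL}_n(\mathbb F_q)$ acts on $\mathbb F_q[x_1,\ldots,x_n]$ (each $x_i$ in degree $1$) by $\sigma f(x_1,\ldots,x_n)=f(\sigma x_1,\ldots,\sigma x_n)$, where $\sigma x_j=\sum_{i=1}^n\sigma_{ij}x_i$. $\mathrm B_n\subset\mathrm{GL}_n(\mathbb F_q)$ is the Borel subgroup of invertible upper triangular matrices. For a graded representation $M$ of a group $G$ over $\mathbb F_q$, the cofixed space (coinvariants) $M_G$ is the graded quotient of $M$ by the $\mathbb F_q$-span of all $\sigma f-f$ with $\sigma\in G$, $f\in M$. *)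

(* Defs.v *)
From HB Require Import structures.
From mathcomp Require Import all_boot all_order all_algebra all_fingroup.
From mathcomp Require boolp.
From mathcomp Require Import mpoly.

Set Implicit Arguments.
Unset Strict Implicit.
Unset Printing Implicit Defensive.

Import GRing.Theory.
Local Open Scope ring_scope.

(* Formal power series R[[t]] in one variable.  Equality is coefficientwise;
   the decidable-equality and choice structures that the ring hierarchy asks
   for are the classical ones. *)
Record fps (R : Type) := Fps { fps_coef : nat -> R }.

Lemma fpsP (R : Type) (f g : fps R) : fps_coef f =1 fps_coef g <-> f = g.
Proof.
split=> [|-> //]; case: f g => f [g] /= fg.
by congr Fps; apply: boolp.funext.
Qed.

HB.instance Definition _ (R : Type) := boolp.gen_eqMixin (fps R).
HB.instance Definition _ (R : Type) := boolp.gen_choiceMixin (fps R).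

Section FpsZmod.
Variable R : zmodType.
Implicit Types f g : fps R.

Definition fps_zero : fps R := Fps (fun=> 0).
Definition fps_add f g := Fps (fun d => fps_coef f d + fps_coef g d).
Definition fps_opp f := Fps (fun d => - fps_coef f d).

Fact fps_addA : associative fps_add.
Proof. by move=> f g h; apply/fpsP => d /=; rewrite addrA. Qed.
Fact fps_addC : commutative fps_add.
Proof. by move=> f g; apply/fpsP => d /=; rewrite addrC. Qed.
Fact fps_add0 : left_id fps_zero fps_add.
Proof. by move=> f; apply/fpsP => d /=; rewrite add0r. Qed.
Fact fps_addN : left_inverse fps_zero fps_opp fps_add.
Proof. by move=> f; apply/fpsP => d /=; rewrite addNr. Qed.

HB.instance Definition _ :=
  GRing.isZmodule.Build (fps R) fps_addA fps_addC fps_add0 fps_addN.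

Lemma fps_coefD f g d : fps_coef (f + g) d = fps_coef f d + fps_coef g d.
Proof. by []. Qed.
Lemma fps_coefN f d : fps_coef (- f) d = - fps_coef f d.
Proof. by []. Qed.
Lemma fps_coef0 d : fps_coef (0 : fps R) d = 0.
Proof. by []. Qed.

End FpsZmod.

Section FpsRing.
Variable R : comNzRingType.
Implicit Types f g : fps R.

Definition fps_one : fps R := Fps (fun d => (d == 0)%:R).
Definition fps_mul f g :=
  Fps (fun d => \sum_(i < d.+1) fps_coef f i * fps_coef g (d - i)).

Definition fps_trunc (k : nat) f : {poly R} := \poly_(i < k) fps_coef f i.

Lemma coef_fps_trunc k f d :
  (d < k)%N -> (fps_trunc k f)`_d = fps_coef f d.
Proof. by move=> dk; rewrite coef_poly dk. Qed.

Lemma fps_mul_trunc k f g d : (d < k)%N ->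
  fps_coef (fps_mul f g) d = (fps_trunc k f * fps_trunc k g)`_d.
Proof.
move=> dk; rewrite coefM; apply: eq_bigr => i _.
rewrite !coef_fps_trunc //; first exact: leq_ltn_trans (leq_subr _ _) dk.
by apply: leq_ltn_trans dk; rewrite -ltnS.
Qed.

Lemma coefM_eq (p p' r r' : {poly R}) d :
    (forall i, (i <= d)%N -> p`_i = p'`_i) ->
    (forall i, (i <= d)%N -> r`_i = r'`_i) ->
  (p * r)`_d = (p' * r')`_d.
Proof.
move=> pp' rr'; rewrite !coefM; apply: eq_bigr => i _.
by rewrite pp' ?rr' ?leq_subr // -ltnS.
Qed.

Fact fps_mulC : commutative fps_mul.
Proof.
by move=> f g; apply/fpsP => d; rewrite !(@fps_mul_trunc d.+1) // mulrC.
Qed.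

Fact fps_mulA : associative fps_mul.
Proof.
move=> f g h; apply/fpsP => d; rewrite !(@fps_mul_trunc d.+1) //.
have tr u v i : (i <= d)%N ->
    (fps_trunc d.+1 (fps_mul u v))`_i
    = (fps_trunc d.+1 u * fps_trunc d.+1 v)`_i.
  by move=> id; rewrite coef_fps_trunc // (@fps_mul_trunc d.+1).
transitivity
  (fps_trunc d.+1 f * (fps_trunc d.+1 g * fps_trunc d.+1 h))`_d.
  by apply: coefM_eq => // i; apply: tr.
by rewrite mulrA; apply: coefM_eq => // i id; rewrite tr.
Qed.

Fact fps_mul1 : left_id fps_one fps_mul.
Proof.
move=> f; apply/fpsP => d /=.
by rewrite big_ord_recl /= mul1r subn0 big1 ?addr0 // => i _; rewrite mul0r.
Qed.

Fact fps_mulDl : left_distributive fps_mul +%R.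
Proof.
move=> f g h; apply/fpsP => d; rewrite fps_coefD /= -big_split /=.
by apply: eq_bigr => i _; rewrite mulrDl.
Qed.

Fact fps_one_neq0 : fps_one != 0.
Proof.
apply/eqP => /fpsP /(_ 0%N) /= /eqP.
by rewrite oner_eq0.
Qed.

HB.instance Definition _ := GRing.Zmodule_isComNzRing.Build (fps R)
  fps_mulA fps_mulC fps_mul1 fps_mulDl fps_one_neq0.

Lemma fps_coef1 d : fps_coef (1 : fps R) d = (d == 0)%:R.
Proof. by []. Qed.
Lemma fps_coefM f g d : fps_coef (f * g) d =
  \sum_(i < d.+1) fps_coef f i * fps_coef g (d - i).
Proof. by []. Qed.

Definition fpsX : fps R := Fps (fun d => (d == 1)%:R).

Lemma fps_coefXn k d : fps_coef (fpsX ^+ k) d = (d == k)%:R.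
Proof.
elim: k d => [//|k IH] [|d].
  by rewrite exprS fps_coefM big_ord_recl big_ord0 /= mul0r addr0.
rewrite exprS fps_coefM big_ord_recl /= mul0r add0r big_ord_recl /=.
rewrite mul1r subn1 IH big1 ?addr0 // => i _.
by rewrite mul0r.
Qed.

End FpsRing.

Section FpsUnitRing.
Variable R : comUnitRingType.
Implicit Types f g : fps R.

Definition fps_unit : pred (fps R) :=
  fun f => fps_coef f 0%N \is a GRing.unit.

(* The coefficients of 1 / f up to degree d, in order. *)
Fixpoint fps_inv_seq f (d : nat) : seq R :=
  if d is d'.+1 then
    let s := fps_inv_seq f d' in
    rcons s (- (fps_coef f 0%N)^-1 *
               \sum_(i < d) fps_coef f i.+1 * s`_(d' - i))
  else [:: (fps_coef f 0%N)^-1].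

Definition fps_inv f : fps R :=
  if fps_unit f then Fps (fun d => (fps_inv_seq f d)`_d) else f.

Lemma size_fps_inv_seq f d : size (fps_inv_seq f d) = d.+1.
Proof. by elim: d => //= d IH; rewrite size_rcons IH. Qed.

Lemma nth_fps_inv_seq f d e : (e <= d)%N ->
  (fps_inv_seq f d)`_e = (fps_inv_seq f e)`_e.
Proof.
elim: d => [|d IH]; first by rewrite leqn0 => /eqP->.
rewrite leq_eqVlt => /orP[/eqP-> //|ed].
by rewrite -IH //= nth_rcons size_fps_inv_seq ed.
Qed.

Fact fps_mulVr : {in fps_unit, left_inverse 1 fps_inv *%R}.
Proof.
move=> f fU; rewrite mulrC; apply/fpsP => d.
have fU0 : fps_coef f 0%N \is a GRing.unit by [].
rewrite /fps_inv (fU : fps_unit f) fps_coefM fps_coef1 big_ord_recl /=.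
case: d => [|d]; first by rewrite big_ord0 addr0 mulrV.
rewrite subn0 [X in _ * X + _]/= nth_rcons size_fps_inv_seq ltnn eqxx.
rewrite mulrA mulrN mulrV // mulN1r.
rewrite addrC; apply/eqP; rewrite subr_eq0; apply/eqP.
apply: eq_bigr => i _.
by rewrite /bump /= add1n subSS [in RHS]nth_fps_inv_seq ?leq_subr.
Qed.

Fact fps_unitPl f g : g * f = 1 -> fps_unit f.
Proof.
move/fpsP/(_ 0%N); rewrite fps_coefM fps_coef1 big_ord_recl big_ord0 addr0 /=.
by move=> gf; apply/unitrPr; exists (fps_coef g 0%N); rewrite mulrC.
Qed.

Fact fps_inv_out : {in [predC fps_unit], fps_inv =1 id}.
Proof. by move=> f /negbTE fN; rewrite /fps_inv -[fps_unit f]/(f \in fps_unit) fN. Qed.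

HB.instance Definition _ := GRing.ComNzRing_hasMulInverse.Build (fps R)
  fps_mulVr fps_unitPl fps_inv_out.

Lemma fps_unitE f : (f \is a GRing.unit) = (fps_coef f 0%N \is a GRing.unit).
Proof. by []. Qed.

Lemma fps_unit_1subXn k : (0 < k)%N -> 1 - fpsX R ^+ k \is a GRing.unit.
Proof.
case: k => // k _; rewrite fps_unitE fps_coefD fps_coefN fps_coef1 fps_coefXn.
by rewrite subr0 unitr1.
Qed.

End FpsUnitRing.

Section Cofixed.
Variables (F : finFieldType) (n : nat).
Implicit Types (s : 'M[F]_n.+1) (p : {mpoly F[n.+1]}).
Implicit Type g : {'GL_n.+1[F]}.
Implicit Type G : {set {'GL_n.+1[F]}}.

Definition mpoly_act s p : {mpoly F[n.+1]} :=
  p \mPo [tuple \sum_i s i j *: 'X_i | j < n.+1].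

Fact mpoly_act_is_linear s : linear (mpoly_act s).
Proof. by move=> c p r; rewrite /mpoly_act linearP. Qed.

HB.instance Definition _ s := GRing.isLinear.Build F {mpoly F[n.+1]}
  {mpoly F[n.+1]} _ (mpoly_act s) (mpoly_act_is_linear s).

Lemma mpoly_actX s j : mpoly_act s 'X_j = \sum_i s i j *: 'X_i.
Proof. by rewrite /mpoly_act comp_mpolyXU -tnth_nth tnth_mktuple. Qed.

Lemma mpoly_act_homog s d p : p \is d.-homog -> mpoly_act s p \is d.-homog.
Proof.
move=> /dhomogP hp; rewrite /mpoly_act comp_mpolyE big_seq.
apply: rpred_sum => m /hp /= <-; apply: rpredZ.
rewrite mdegE; apply: (big_ind2 (fun q e => q \is e.-homog)).
- exact: dhomog1.
- by move=> ? ? ? ?; apply: dhomogM.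
move=> i _; rewrite -[X in X.-homog]mul1n; apply: dhomogMn.
rewrite tnth_mktuple; apply: rpred_sum => k _; apply: rpredZ.
by rewrite dhomogX /= mdeg1.
Qed.

Definition dhomog_act d s (p : dhomog n.+1 F d) : dhomog n.+1 F d :=
  DHomog (mpoly_act_homog s (dhomog_is_dhomog p)).

Definition dhomog_actB d s (p : dhomog n.+1 F d) : dhomog n.+1 F d :=
  dhomog_act s p - p.

Fact dhomog_actB_is_linear d s : linear (@dhomog_actB d s).
Proof.
move=> c p r; apply: val_inj; rewrite /= !linearP /=.
by rewrite scalerBr scalerN addrACA.
Qed.

HB.instance Definition _ d s := GRing.isLinear.Build F (dhomog n.+1 F d)
  (dhomog n.+1 F d) _ (@dhomog_actB d s) (@dhomog_actB_is_linear d s).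

(* Degree d part of the span of all s f - f with s in G; see cofix_relP. *)
Definition cofix_rel G d : {vspace dhomog n.+1 F d} :=
  (\sum_(s in G) limg (linfun (@dhomog_actB d (GLval s))))%VS.

Lemma pihomog_act d s p :
  pihomog mdeg d (mpoly_act s p) = mpoly_act s (pihomog mdeg d p).
Proof.
have pE := @pihomog_partitionE _ _ mdeg _ p (leqnn _).
rewrite [in LHS]pE [in RHS]pE (linear_sum (mpoly_act s)).
rewrite !(linear_sum (pihomog mdeg d)) (linear_sum (mpoly_act s)).
apply: eq_bigr => e _.
have hom := mpoly_act_homog s (pihomogP mdeg e p).
case: (eqVneq (e : nat) d) => [<-|ned].
  by rewrite [LHS](pihomog_dE hom) [X in _ = _ X]pihomog_id.
rewrite [LHS](pihomog_ne0 ned hom).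
by rewrite [X in _ = _ X](pihomog_ne0 ned (pihomogP mdeg e p)) raddf0.
Qed.

Lemma cofix_relP G d (v : dhomog n.+1 F d) :
  v \in cofix_rel G d <->
  exists r : seq (F * {'GL_n.+1[F]} * {mpoly F[n.+1]}),
    all (fun x => x.1.2 \in G) r /\
    (v : {mpoly F[n.+1]}) =
      \sum_(x <- r) x.1.1 *: (mpoly_act (GLval x.1.2) x.2 - x.2).
Proof.
split=> [/memv_sumP[w wG ->]|[r [rG vE]]].
  have /fin_all_exists[u uE] g : exists u : dhomog n.+1 F d,
      g \in G -> w g = dhomog_actB (GLval g) u.
    have [gG|] := boolP (g \in G); last by exists 0.
    by have /memv_imgP[u _ ->] := wG g gG; exists u => _; rewrite lfunE.
  exists [seq (1, g, u g : {mpoly F[n.+1]}) | g <- enum G]; split.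
    by apply/allP => _ /mapP[g + ->] /=; rewrite mem_enum.
  rewrite big_map big_enum linear_sum /=; apply: eq_bigr => g gG.
  by rewrite uE // scale1r.
pose u (x : F * {'GL_n.+1[F]} * {mpoly F[n.+1]}) : dhomog n.+1 F d :=
  DHomog (pihomogP mdeg d x.2).
have -> : v = \sum_(x <- r) x.1.1 *: dhomog_actB (GLval x.1.2) (u x).
  have := congr1 (pihomog mdeg d) vE.
  rewrite [LHS](pihomog_dE (dhomog_is_dhomog v)) => vE'.
  apply: val_inj; rewrite [LHS]vE' (linear_sum (pihomog mdeg d)).
  rewrite (linear_sum (@mpoly_of_dhomog _ _ _)); apply: eq_bigr => x _.
  rewrite linearZ [RHS]linearZ linearB; congr (_ *: _).
  exact: (congr1 (fun y => y - _) (pihomog_act _ _ _)).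
rewrite big_seq; apply: memv_suml => x /(allP rG) xG; apply: memvZ.
apply: (subvP (sumv_sup x.1.2 xG (subvv _))).
by apply/memv_imgP; exists (u x); rewrite ?memvf // lfunE.
Qed.

Definition cofix_dim G d : nat :=
  \dim {: dhomog n.+1 F d} - \dim (cofix_rel G d).

Definition cofix_hilbert G : fps int := Fps (fun d => (cofix_dim G d)%:Z).

Definition borel : {set {'GL_n.+1[F]}} :=
  [set s | is_trig_mx (GLval s)^T].

Lemma borelP (s : {'GL_n.+1[F]}) :
  reflect (forall i j : 'I_n.+1, (j < i)%N -> GLval s i j = 0) (s \in borel).
Proof.
rewrite inE; apply: (iffP is_trig_mxP) => H i j ij.
  by have := H j i ij; rewrite mxE.
by rewrite mxE H.
Qed.

End Cofixed.

Arguments borel : clear implicits.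
Arguments fpsX {R}.

Definition partial_sum n (beta : {ffun 'I_n -> bool}) (i : 'I_n) : nat :=
  \sum_(j < n | (j <= i)%N) beta j.

(* Main.v *)
From HB Require Import structures.
Require Import Defs.
From mathcomp Require Import all_boot all_order all_algebra all_fingroup.
From mathcomp Require Import finfield.
From mathcomp Require Import mpoly zify ring.

Set Implicit Arguments.
Unset Strict Implicit.
Unset Printing Implicit Defensive.

Import GRing.Theory.
Local Open Scope ring_scope.

(** The series satisfies a recursion on the number of variables: splitting the
    sum according to the first entry of [beta] gives
      [H_(n+1)(t) = H_n(t) + t^((n+1)(q-1)) / (1 - t^(q-1)) H_n(t^q)].
    The same recursion counts the good monomials: a monomial in
    [x_0, x_1, ..., x_n] is good when it is a good monomial in [x_1, ..., x_n],
    or when it has the form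
      [x_0^((q-1) i) (x_1 ... x_n)^(q-1) b(x_1^q, ..., x_n^q)]
    with [i > 0] and [b] good.  So the theorem follows from the fact that the
    good monomials of degree [d] form a basis of the cofixed space.

    They span it ([good_span]).  Work modulo relations and modulo higher powers
    of [x_0], and consider [x_0^k x^a] with [k > 0].  The torus kills it unless
    [q - 1] divides [k].  The transvections [x_j |-> x_j + c x_0] kill it unless
    every [a_j] is [-1] modulo [q].  What is left has the form
    [x_0^k (x_1 ... x_n)^(q-1) f(x^q)], and triangular substitutions in
    [x_1, ..., x_n] act on it through [f], because raising to the [q]-th power
    commutes with them and because the coefficient of [(x_1 ... x_n)^(q-1)] is
    invariant under invertible substitutions, being up to sign the sum of the
    values over all points.  Induction on the number of variables applies to
    [f], and for [k = 0] it applies directly.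

    They are independent ([good_free]).  Setting [x_0 = 0] disposes of the
    monomials without [x_0].  For the others, the trace over the group of
    substitutions [x_j |-> x_j + c_j x_0] is equivariant, and with [x_0] set to
    [1] its values are polynomials in [y_j = x_j^q - x_j].  Written in the
    variables [y_j] the trace is, up to sign, the residue of the polynomial.  The
    triangular group acts on the homogeneous parts of the residue by linear
    substitutions, up to a power of the first diagonal entry that is trivial in
    the relevant degrees, so the residue maps relations to relations in one
    variable less.  The residue of [x_0^k (x_1 ... x_n)^(q-1) b(x^q)] is [b(y)] plus
    terms of lower degree, so the good monomials with the smallest [k] in a
    putative relation give a relation between good monomials in [n] variables. *)

(** * Power sums over a finite field *)

Section FiniteField.
Variable F : finFieldType.
Local Notation q := #|F|.

Lemma card_gt1 : (1 < q)%N.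
Proof. exact: finNzRing_gt1. Qed.

Lemma card_gt0 : (0 < q)%N.
Proof. exact: ltnW card_gt1. Qed.

Lemma predn_card_gt0 : (0 < q.-1)%N.
Proof. by have := card_gt1; case: q => [|[]]. Qed.

Lemma expf_card1 (c : F) : c != 0 -> c ^+ q.-1 = 1.
Proof.
move=> c0; apply: (mulfI c0); rewrite mulr1 -exprS prednK ?card_gt0 //.
exact: expf_card.
Qed.

Lemma expf_dvd (c : F) i : c != 0 -> (q.-1 %| i)%N -> c ^+ i = 1.
Proof.
by move=> c0 /dvdnP[k ->]; rewrite mulnC exprM expf_card1 // expr1n.
Qed.

Lemma card_pnat : [pchar F].-nat q.
Proof.
have [p pr pF] := finPcharP F; rewrite (eq_pnat _ (pcharf_eq pF)).
by rewrite (card_pprimeChar pF) pnatX pnat_id.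
Qed.

Lemma natr_card : q%:R = 0 :> F.
Proof.
have [p pr pF] := finPcharP F; have := card_gt1.
rewrite (card_pprimeChar pF); case: (logn _ _) => // k _.
by rewrite natrX pcharf0 // expr0n.
Qed.

Lemma exprDq (A : comAlgType F) (x y : A) : (x + y) ^+ q = x ^+ q + y ^+ q.
Proof.
rewrite exprDn_pchar // (eq_pnat _ (pchar_lalg A)); exact: card_pnat.
Qed.

(** A nonzero polynomial cannot have more roots than its degree, so no
   positive exponent below [q - 1] kills the whole multiplicative group. *)
Lemma exists_expf_neq1 i : ~~ (q.-1 %| i)%N ->
  exists2 c : F, c != 0 & c ^+ i != 1.
Proof.
move=> ndv; set r := (i %% q.-1)%N.
have r0 : (0 < r)%N by rewrite lt0n.
have rq : (r < q.-1)%N by rewrite ltn_mod predn_card_gt0.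
have [/existsP[c /andP[c0 cr]]|] :=
    boolP [exists c : F, (c != 0) && (c ^+ r != 1)].
  exists c => //; apply: contra cr.
  by rewrite {1}(divn_eq i q.-1) exprD expf_dvd ?dvdn_mull // mul1r.
rewrite negb_exists => /forallP all1.
have rt : all (root ('X^r - 1%:P)) [seq c <- enum F | c != 0].
  apply/allP => c; rewrite mem_filter => /andP[c0 _].
  have := all1 c; rewrite c0 negbK => /eqP cr.
  by rewrite rootE !hornerE cr subrr.
have sz : size ('X^r - 1%:P : {poly F}) = r.+1 by rewrite size_XnsubC.
have := max_poly_roots _ rt.
rewrite -size_poly_eq0 sz => /(_ isT).
rewrite filter_uniq ?enum_uniq // => /(_ isT).
have -> : size [seq c <- enum F | c != 0] = q.-1.
  rewrite -(cardC1 (0 : F)) cardE; congr size.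
  by rewrite enumT [RHS]/enum_mem; apply: eq_filter.
by rewrite ltnS => /leq_ltn_trans/(_ rq); rewrite ltnn.
Qed.

Lemma sum_expf i : \sum_(c : F) c ^+ i =
  if (0 < i)%N && (q.-1 %| i)%N then -1 else 0.
Proof.
have [->|i0] := posnP i.
  by rewrite (eq_bigr (fun=> 1)) // sumr_const natr_card.
case: ifPn => [dv|ndv].
  rewrite (bigD1 0) //= expr0n eqn0Ngt i0 add0r.
  rewrite (eq_bigr (fun=> 1)) => [|c c0]; last by rewrite expf_dvd.
  rewrite sumr_const cardC1; apply/eqP; rewrite -subr_eq0 opprK -mulrSr.
  by rewrite prednK ?card_gt0 // natr_card.
have [a a0 ai] := exists_expf_neq1 ndv.
apply/eqP; have : a ^+ i * \sum_(c : F) c ^+ i = \sum_(c : F) c ^+ i.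
  rewrite mulr_sumr [RHS](reindex_inj (mulfI a0)) /=.
  by apply: eq_bigr => c _; rewrite exprMn.
move/eqP; rewrite -subr_eq0 -{2}[\sum_c _]mul1r -mulrBl mulf_eq0.
by rewrite subr_eq0 (negPf ai).
Qed.

Lemma sum_expf_small i : (i < q.-1)%N -> \sum_(c : F) c ^+ i = 0.
Proof.
move=> iq; rewrite sum_expf; case: ifP => // /andP[i0 /dvdn_leq].
by move=> /(_ i0); rewrite leqNgt iq.
Qed.

Lemma sum_expf_predq : \sum_(c : F) c ^+ q.-1 = -1.
Proof. by rewrite sum_expf predn_card_gt0 dvdnn. Qed.

End FiniteField.

(** * Splitting off the first variable *)

Section Cons.
Variables (T : Type) (n : nat).

Definition consf (a : T) (v : 'I_n -> T) (i : 'I_n.+1) : T :=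
  if unlift ord0 i is Some j then v j else a.

Lemma consf0 a v : consf a v ord0 = a.
Proof. by rewrite /consf unlift_none. Qed.

Lemma consfS a v j : consf a v (lift ord0 j) = v j.
Proof. by rewrite /consf liftK. Qed.

Lemma ordP (P : 'I_n.+1 -> Prop) :
  P ord0 -> (forall j, P (lift ord0 j)) -> forall i, P i.
Proof. by move=> P0 PS i; case: (unliftP ord0 i) => [j ->|->]. Qed.

End Cons.

Section Multinomials.
Variables (n : nat).
Implicit Type m : 'X_{1..n}.

Definition mcons k m : 'X_{1..n.+1} := [multinom consf k m i | i < n.+1].
Definition mtail (m : 'X_{1..n.+1}) : 'X_{1..n} :=
  [multinom m (lift ord0 j) | j < n].

Lemma mcons0 k m : mcons k m ord0 = k.
Proof. by rewrite mnmE consf0. Qed.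

Lemma mconsS k m j : mcons k m (lift ord0 j) = m j.
Proof. by rewrite mnmE consfS. Qed.

Lemma mtail_cons k m : mtail (mcons k m) = m.
Proof. by apply/mnmP => j; rewrite mnmE mconsS. Qed.

Lemma mcons_tail (m : 'X_{1..n.+1}) : mcons (m ord0) (mtail m) = m.
Proof. by apply/mnmP; apply: ordP => [|j]; rewrite ?mcons0 ?mconsS ?mnmE. Qed.

Lemma mdeg_cons k m : mdeg (mcons k m) = (k + mdeg m)%N.
Proof.
rewrite !mdegE big_ord_recl mcons0; congr addn.
by apply: eq_bigr => j _; rewrite mconsS.
Qed.

Lemma mdeg_tail (m : 'X_{1..n.+1}) : mdeg m = (m ord0 + mdeg (mtail m))%N.
Proof. by rewrite -{1}[m]mcons_tail mdeg_cons. Qed.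

End Multinomials.

(** * Substitutions, the triangular action and its relations *)

Section Substitution.
Variable F : finFieldType.
Local Notation q := #|F|.

Definition sbst n k (v : 'I_n -> {mpoly F[k]}) (p : {mpoly F[n]}) :
  {mpoly F[k]} := p \mPo [tuple v i | i < n].

HB.instance Definition _ n k (v : 'I_n -> {mpoly F[k]}) :=
  GRing.RMorphism.copy (sbst v) (comp_mpoly [tuple v i | i < n]).
HB.instance Definition _ n k (v : 'I_n -> {mpoly F[k]}) :=
  GRing.Linear.copy (sbst v) (comp_mpoly [tuple v i | i < n]).

Lemma linear_mpolyE n (V : lmodType F) (L : {linear {mpoly F[n]} -> V}) p :
  L p = \sum_(m <- msupp p) p@_m *: L 'X_[m].
Proof.
rewrite {1}[p]mpolyE linear_sum; apply: eq_bigr => m _.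
by rewrite linearZ.
Qed.

Section Basics.
Variables n k : nat.
Implicit Types (v : 'I_n -> {mpoly F[k]}) (p : {mpoly F[n]}).

Lemma sbstX v i : sbst v 'X_i = v i.
Proof. by rewrite /sbst comp_mpolyXU -tnth_nth tnth_mktuple. Qed.

Lemma sbstXm v m : sbst v 'X_[m] = \prod_i v i ^+ m i.
Proof.
by rewrite /sbst comp_mpolyX; apply: eq_bigr => i _; rewrite tnth_mktuple.
Qed.

Lemma sbstE v p :
  sbst v p = \sum_(m <- msupp p) p@_m *: \prod_i v i ^+ m i.
Proof.
rewrite linear_mpolyE; apply: eq_bigr => m _ /=.
by rewrite sbstXm.
Qed.

Lemma eq_sbst v v' : v =1 v' -> sbst v =1 sbst v'.
Proof.
move=> vv p; rewrite !sbstE; apply: eq_bigr => m _; congr (_ *: _).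
by apply: eq_bigr => i _; rewrite vv.
Qed.

Lemma meval_sbst v x p : (sbst v p).@[x] = p.@[fun i => (v i).@[x]].
Proof.
rewrite comp_mpoly_meval; apply: meval_eq => i.
by rewrite tnth_mktuple.
Qed.

Lemma sbst_homog v p d e : (forall i, v i \is e.-homog) ->
  p \is d.-homog -> sbst v p \is (e * d).-homog.
Proof.
move=> hv /dhomogP hp; rewrite sbstE big_seq.
apply: rpred_sum => m /hp /= <-; apply: rpredZ.
rewrite mdegE big_distrr /=.
apply: (big_ind2 (fun x y => x \is y.-homog)) => [|? ? ? ?|i _].
- exact: dhomog1.
- exact: dhomogM.
exact: dhomogMn.
Qed.

End Basics.

Lemma sbst_id n (p : {mpoly F[n]}) : sbst (fun i => 'X_i) p = p.
Proof.
by rewrite sbstE [RHS]mpolyE; apply: eq_bigr => m _; rewrite -mpolyXE_id.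
Qed.

Lemma sbst_sbst n k l (u : 'I_k -> {mpoly F[l]}) (v : 'I_n -> {mpoly F[k]}) p :
  sbst u (sbst v p) = sbst (fun i => sbst u (v i)) p.
Proof.
rewrite [sbst v p]sbstE [RHS]sbstE linear_sum /=; apply: eq_bigr => m _.
rewrite linearZ rmorph_prod /=; congr (_ *: _).
by apply: eq_bigr => i _; rewrite rmorphXn.
Qed.

Definition act n (s : 'M[F]_n) : {mpoly F[n]} -> {mpoly F[n]} :=
  sbst (fun j => \sum_i s i j *: 'X_i).

HB.instance Definition _ n (s : 'M[F]_n) := GRing.RMorphism.on (act s).
HB.instance Definition _ n (s : 'M[F]_n) := GRing.Linear.on (act s).

Lemma actX n (s : 'M[F]_n) j : act s 'X_j = \sum_i s i j *: 'X_i.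
Proof. exact: sbstX. Qed.

Lemma act_homog n (s : 'M[F]_n) d p : p \is d.-homog -> act s p \is d.-homog.
Proof.
rewrite -{2}[d]mul1n; apply: sbst_homog => j.
by apply: rpred_sum => i _; apply: rpredZ; rewrite dhomogX /= mdeg1.
Qed.

Lemma sbst_act n k (v : 'I_n -> {mpoly F[k]}) s p :
  sbst v (act s p) = sbst (fun j => \sum_i s i j *: v i) p.
Proof.
rewrite /act sbst_sbst; apply: eq_sbst => j.
by rewrite linear_sum; apply: eq_bigr => i _; rewrite linearZ /= sbstX.
Qed.

Lemma act_sbst n k (v : 'I_n -> {mpoly F[k]}) s p :
  act s (sbst v p) = sbst (fun j => act s (v j)) p.
Proof. exact: sbst_sbst. Qed.

Definition uptri n (s : 'M[F]_n) : bool :=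
  [forall i, s i i != 0] &&
  [forall i : 'I_n, forall j : 'I_n, (j < i)%N ==> (s i j == 0)].

Lemma uptriP n (s : 'M[F]_n) :
  reflect ((forall i, s i i != 0) /\ (forall i j : 'I_n, (j < i)%N -> s i j = 0))
    (uptri s).
Proof.
apply: (iffP andP) => [[/forallP d /'forall_forallP u]|[d u]].
  by split=> // i j ij; apply/eqP/(implyP (u i j)).
split; first exact/forallP.
by apply/'forall_forallP => i j; apply/implyP => ij; rewrite u.
Qed.

Lemma uptri_unit n (s : 'M[F]_n) : uptri s -> s \in unitmx.
Proof.
case/uptriP => d u; rewrite unitmxE -det_tr det_trig; last first.
  by apply/is_trig_mxP => i j ij; rewrite mxE u.
by rewrite unitfE; apply/prodf_neq0 => i _; rewrite mxE.
Qed.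

(** The span of the [s f - f] needs no scalars, because [f] ranges over a
    vector space.  Fixing the degree of [f] is what makes setting [x_0 = 1]
    harmless in the study of the trace. *)
Inductive rel n d : {mpoly F[n]} -> Prop :=
| Rel0 : rel d 0
| RelS p s f : rel d p -> uptri s -> f \is d.-homog ->
    rel d (p + (act s f - f)).

Section Rel.
Variables n d : nat.
Implicit Types (p f : {mpoly F[n]}) (s : 'M[F]_n).

Lemma rel_act s f : uptri s -> f \is d.-homog -> rel d (act s f - f).
Proof. by move=> us fd; rewrite -[_ - _]add0r; apply: RelS (Rel0 _ _) _ _. Qed.

Lemma relD p p' : rel d p -> rel d p' -> rel d (p + p').
Proof.
move=> rp; elim=> [|r s f _ IH us fd]; first by rewrite addr0.
by rewrite addrA; apply: RelS.
Qed.

Lemma relZ c p : rel d p -> rel d (c *: p).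
Proof.
elim=> [|r s f _ IH us fd]; first by rewrite scaler0; apply: Rel0.
rewrite scalerDr scalerBr -linearZ /=; apply: RelS => //.
exact: rpredZ.
Qed.

Lemma rel_sum (I : Type) (r : seq I) (P : pred I) (E : I -> {mpoly F[n]}) :
  (forall i, P i -> rel d (E i)) -> rel d (\sum_(i <- r | P i) E i).
Proof. by move=> H; apply: big_ind => //; [apply: Rel0 | apply: relD]. Qed.

Lemma rel_homog p : rel d p -> p \is d.-homog.
Proof.
elim=> [|r s f _ IH us fd]; first exact: dhomog0.
by rewrite rpredD // rpredB // act_homog.
Qed.

End Rel.

(** The two alternatives correspond to the two summands of the recursion for
    the Hilbert series. *)
Fixpoint good n : 'X_{1..n} -> bool :=
  match n with
  | 0 => fun=> true
  | n'.+1 => fun m : 'X_{1..n'.+1} =>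
      (m ord0 == 0%N) && good (mtail m) ||
      [&& (0 < m ord0)%N, (q.-1 %| m ord0)%N,
          [forall j, (q %| (mtail m j).+1)%N] &
          good [multinom (mtail m j %/ q)%N | j < n']]
  end.

End Substitution.

(** * Frobenius and the monomial with all exponents [q - 1] *)

Section Frobenius.
Variable F : finFieldType.
Local Notation q := #|F|.

Lemma sum_exprq (A : comAlgType F) (I : Type) (r : seq I) (c : I -> F)
    (x : I -> A) :
  (\sum_(i <- r) c i *: x i) ^+ q = \sum_(i <- r) c i *: x i ^+ q.
Proof.
elim: r => [|i r IH]; first by rewrite !big_nil expr0n eqn0Ngt card_gt0.
by rewrite !big_cons exprDq IH exprZn expf_card.
Qed.

Lemma coef_1addX n k : ((1 + 'X) ^+ n : {poly F})`_k = 'C(n, k)%:R.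
Proof.
elim: n k => [|n IH] k; first by rewrite expr0 coef1 bin0n.
rewrite exprS mulrDl mul1r coefD coefXM !IH.
by case: k => [|k]; rewrite ?bin0 ?addr0 // binS natrD.
Qed.

(** As the [q]-th power is additive, [(1 + X)^(q M)] is a polynomial in [X^q]. *)
Lemma bin_mulq_eq0 M k : (0 < k < q)%N -> 'C(q * M, k)%:R = 0 :> F.
Proof.
case/andP=> k0 kq; rewrite -coef_1addX exprM exprDq expr1n.
elim: M => [|M IH]; first by rewrite expr0 coef1 eqn0Ngt k0.
by rewrite exprS mulrDl mul1r coefD IH coefXnM kq addr0.
Qed.

(** The binomials ['C(q M, k)] vanish for [0 < k < q], so Pascal's rule makes
    consecutive ['C(q M - 1, k)] opposite. *)
Lemma bin_predq A k : (q %| A.+1)%N -> (k < q)%N ->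
  'C(A, k)%:R = (-1) ^+ k :> F.
Proof.
case/dvdnP => M; rewrite mulnC => eA; elim: k => [|k IH] kq; first by rewrite bin0.
have := @bin_mulq_eq0 M k.+1 kq; rewrite -eA binS natrD.
by rewrite IH ?(ltnW kq) // exprS mulN1r => /eqP; rewrite addr_eq0 => /eqP.
Qed.

Definition topm n : 'X_{1..n} := [multinom q.-1 | i < n].

Lemma mdeg_topm n : mdeg (topm n) = (n * q.-1)%N.
Proof.
rewrite mdegE (eq_bigr (fun=> q.-1)) => [|i _]; last by rewrite mnmE.
by rewrite sum_nat_const card_ord.
Qed.

Lemma eq_topm n (m : 'X_{1..n}) : mdeg m = (n * q.-1)%N ->
  (forall j, q.-1 <= m j)%N -> m = topm n.
Proof.
move=> dm le; apply/mnmP => i; rewrite mnmE.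
have := @leqif_sum _ predT (fun j => q.-1 == m j)
  (fun=> q.-1) (fun j => m j) (fun j _ => leqif_eq (le j)).
rewrite sum_nat_const card_ord -mdegE dm => -[_].
by rewrite eqxx => /esym/forallP/(_ i) /= /eqP ->.
Qed.

Lemma mdeg_top n (b : 'X_{1..n}) :
  mdeg (topm n + b *+ q)%MM = (n * q.-1 + q * mdeg b)%N.
Proof. by rewrite mdegD mdegMn mdeg_topm (mulnC q). Qed.

Lemma topD_inj n : injective (fun b : 'X_{1..n} => (topm n + b *+ q)%MM).
Proof.
move=> b c /mnmP e; apply/mnmP => j; have := e j.
rewrite !mnmDE !mulmnE => /addnI /eqP.
by rewrite eqn_pmul2r ?card_gt0 // => /eqP.
Qed.

Lemma topm_divn n (m : 'X_{1..n}) : (forall j, q %| (m j).+1)%N ->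
  m = (topm n + [multinom (m j %/ q)%N | j < n] *+ q)%MM.
Proof.
move=> qm; apply/mnmP => j; rewrite mnmDE mulmnE !mnmE.
have /dvdnP[k ek] := qm j; have k0 : (0 < k)%N by case: k ek.
have -> : m j = (k.-1 * q + q.-1)%N.
  apply: succn_inj; rewrite ek -addnS prednK ?card_gt0 //.
  by rewrite addnC -mulSn prednK.
rewrite divnMDl ?card_gt0 // divn_small ?addn0 ?ltn_predL ?card_gt0 //.
by rewrite addnC.
Qed.

Lemma sum_prod_expf n (a : 'I_n -> nat) :
  \sum_(v : {ffun 'I_n -> F}) \prod_i v i ^+ a i =
  \prod_i \sum_(c : F) c ^+ a i.
Proof. by rewrite (bigA_distr_bigA (fun i c => c ^+ a i)). Qed.

(** A monomial sums to zero over all points as soon as one exponent is below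
   [q - 1], which degree [n (q - 1)] forces for every monomial but one. *)
Lemma sum_meval_top n (g : {mpoly F[n]}) : g \is (n * q.-1).-homog ->
  \sum_(v : {ffun 'I_n -> F}) g.@[v] = g@_(topm n) * (-1) ^+ n.
Proof.
move=> /dhomogP hg; under eq_bigr => v _ do rewrite mevalE.
rewrite exchange_big /=.
have E m : m \in msupp g -> \sum_(v : {ffun 'I_n -> F})
    g@_m * \prod_i v i ^+ m i = if m == topm n then g@_m * (-1) ^+ n else 0.
  move=> /hg /= dm; rewrite -mulr_sumr sum_prod_expf; case: eqP => [->|ne].
    rewrite (eq_bigr (fun=> -1)) => [|i _]; last by rewrite mnmE sum_expf_predq.
    by rewrite prodr_const card_ord.
  have [i mi|no] := pickP (fun i => (m i < q.-1)%N).
    by rewrite (bigD1 i) //= sum_expf_small // mul0r mulr0.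
  by case: ne; apply: eq_topm => // j; rewrite leqNgt no.
rewrite big_seq (eq_bigr _ E) -big_seq -big_mkcond /=.
have [gT|gT] := boolP (topm n \in msupp g).
  by rewrite (big_rem _ gT) /= eqxx big_seq_cond big1 ?addr0 // => m;
     rewrite mem_rem_uniq // inE => /andP[/andP[/negPf->]].
rewrite (memN_msupp_eq0 gT) mul0r big_seq_cond big1 // => m /andP[mg /eqP e].
by rewrite e (negPf gT) in mg.
Qed.

(** The coefficient is up to sign a sum over all points, and [s] permutes the
    points. *)
Lemma mcoeff_top_act n (s : 'M[F]_n) g : s \in unitmx ->
  g \is (n * q.-1).-homog -> (act s g)@_(topm n) = g@_(topm n).
Proof.
move=> us hg; have n0 : (-1) ^+ n != 0 :> F by rewrite signr_eq0.
apply: (mulIf n0).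
rewrite -!sum_meval_top ?act_homog //.
pose h (v : {ffun 'I_n -> F}) := [ffun j => \sum_i s i j * v i].
have hI : injective h.
  move=> v w vw; pose r (v : {ffun 'I_n -> F}) := \row_j v j.
  have hE u : r (h u) = r u *m s.
    apply/rowP => j; rewrite !mxE ffunE; apply: eq_bigr => i _.
    by rewrite mxE mulrC.
  have /rowP e : r v = r w.
    by apply: (can_inj (mulmxK us)); rewrite -!hE vw.
  by apply/ffunP => j; have := e j; rewrite !mxE.
rewrite [RHS](reindex_inj hI) /=; apply: eq_bigr => v _.
rewrite meval_sbst; apply: meval_eq => j; rewrite ffunE raddf_sum /=.
by apply: eq_bigr => i _; rewrite mevalZ mevalXU.
Qed.

End Frobenius.

(** * Reducing monomials modulo relations *)

Section Upper.
Variable F : finFieldType.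
Local Notation q := #|F|.

Section Span.
Variables n d : nat.
Implicit Types (p f : {mpoly F[n]}) (m : 'X_{1..n}).

Definition spanned p : Prop :=
  exists w : {mpoly F[n]}, {subset msupp w <= @good F n} /\ rel d (p - w).

Lemma spanned_rel p : rel d p -> spanned p.
Proof. by exists 0; split; rewrite ?subr0 // => m; rewrite msupp0. Qed.

Lemma spanned_good m : good F m -> spanned 'X_[m].
Proof.
move=> gm; exists 'X_[m]; split; last by rewrite subrr; apply: Rel0.
by move=> m'; rewrite msuppX inE => /eqP ->.
Qed.

Lemma spannedD p p' : spanned p -> spanned p' -> spanned (p + p').
Proof.
move=> [w [gw rw]] [w' [gw' rw']]; exists (w + w'); split; last first.
  by rewrite opprD addrACA; apply: relD.
move=> m /msuppD_le; rewrite mem_cat => /orP[]; [exact: gw|exact: gw'].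
Qed.

Lemma spannedZ c p : spanned p -> spanned (c *: p).
Proof.
move=> [w [gw rw]]; exists (c *: w); split; last by rewrite -scalerBr; apply: relZ.
by move=> m /msuppZ_le; apply: gw.
Qed.

Lemma spanned0 : spanned 0.
Proof. exact/spanned_rel/Rel0. Qed.

Lemma spanned_sum (I : Type) (r : seq I) (P : pred I) (E : I -> {mpoly F[n]}) :
  (forall i, P i -> spanned (E i)) -> spanned (\sum_(i <- r | P i) E i).
Proof. by move=> H; apply: big_ind => //; [apply: spanned0 | apply: spannedD]. Qed.

Lemma spanned_linear k (L : {linear {mpoly F[k]} -> {mpoly F[n]}})
    (p : {mpoly F[k]}) :
  (forall m : 'X_{1..k}, m \in msupp p -> spanned (L 'X_[m])) -> spanned (L p).
Proof.
move=> H; rewrite linear_mpolyE big_seq; apply: spanned_sum => m mp.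
exact/spannedZ/H.
Qed.

End Span.

(** The torus scales a monomial by a character, which is nontrivial here. *)
Lemma rel_torus n (m : 'X_{1..n}) i : ~~ (q.-1 %| m i)%N ->
  rel (mdeg m) ('X_[F, m]).
Proof.
case/exists_expf_neq1 => c c0 cm.
pose s : 'M[F]_n := \matrix_(a, b) if a == b then (if a == i then c else 1) else 0.
have us : uptri s.
  apply/uptriP; split=> [a|a b ba]; rewrite mxE ?eqxx.
    by case: ifP => // _; apply: oner_neq0.
  by rewrite ifN // -val_eqE /= neq_ltn ba orbT.
have aX : act s 'X_[m] = c ^+ m i *: 'X_[m].
  rewrite /act sbstXm (eq_bigr (fun j => (if j == i then c else 1) ^+ m j *:
    'X_j ^+ m j)) => [|j _]; last first.
    rewrite (bigD1 j) //= mxE eqxx big1 ?addr0 ?exprZn // => a aj.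
    by rewrite mxE (negPf aj) scale0r.
  rewrite scaler_prod -mpolyXE_id; congr (_ *: _).
  rewrite (bigD1 i) //= eqxx big1 ?mulr1 // => j /negPf ->.
  exact: expr1n.
have := rel_act us (f := 'X_[m]) (d := mdeg m).
rewrite dhomogX eqxx => /(_ isT) /(relZ (c ^+ m i - 1)^-1).
rewrite aX -{2}['X_[m]]scale1r -scalerBl scalerA mulVf ?scale1r //.
by rewrite subr_eq0.
Qed.

Section Transvection.
Variables (n : nat) (m : 'X_{1..n.+1}) (j : 'I_n).
Hypothesis m0 : (0 < m ord0)%N.
Hypothesis qm0 : (q.-1 %| m ord0)%N.
Hypothesis qmj : ~~ (q %| (m (lift ord0 j)).+1)%N.

Let lj := lift ord0 j.

Definition transv c : 'M[F]_n.+1 := 1%:M + c *: delta_mx ord0 lj.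

Lemma transv_uptri c : uptri (transv c).
Proof.
apply/uptriP; split=> [a|a b ba]; rewrite !mxE ?eqxx.
  have -> : (a == @ord0 n) && (a == lj) = false.
    by apply/andP => -[/eqP -> /eqP/(congr1 val)].
  by rewrite mulr0 addr0 oner_neq0.
have -> : (a == ord0) = false by apply/eqP => a0; rewrite a0 in ba.
by rewrite mulr0 addr0 -val_eqE /= gtn_eqF.
Qed.

Lemma act_transvX c i :
  act (transv c) 'X_i = 'X_i + (c *+ (i == lj)) *: 'X_(@ord0 n).
Proof.
rewrite actX; transitivity (\sum_(a : 'I_n.+1)
  ((1%:M : 'M[F]_n.+1) a i *: ('X_a : {mpoly F[n.+1]}) +
   (c *: delta_mx (@ord0 n) lj : 'M[F]_n.+1) a i *: 'X_a)).
  by apply: eq_bigr => a _; rewrite mxE scalerDl.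
rewrite big_split /=; congr (_ + _).
  rewrite (bigD1 i) //= !mxE eqxx scale1r big1 ?addr0 // => a /negPf ai.
  by rewrite mxE ai scale0r.
rewrite (bigD1 ord0) //= !mxE eqxx /= big1 ?addr0 => [|a /negPf a0].
  by rewrite mulr_natr.
by rewrite !mxE a0 mulr0 scale0r.
Qed.

(** Averaging the relations of the transvections [x_j |-> x_j + c x_0] applied
   to [x_0^(m_0 - i) x_j^(m_j + i)] against the character [c^(q-1-i)] isolates
   the terms with [x_0]-exponent [m_0] or more; the choice of [i] with
   [m_j + i = -1] modulo [q] makes the coefficient of [x^m] invertible. *)
Lemma spanned_transv :
  (forall m' : 'X_{1..n.+1}, mdeg m' = mdeg m -> (m ord0 < m' ord0)%N ->
     spanned (mdeg m) ('X_[F, m'])) ->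
  spanned (mdeg m) ('X_[F, m]).
Proof.
move=> H; have q0 := card_gt0 F; have q1 := card_gt1 F.
(* The least [i > 0] with [m_j + i = -1] modulo [q]; it is less than [q]. *)
pose i := (q - ((m lj).+1 %% q))%N.
have r0 : (0 < (m lj).+1 %% q)%N by rewrite lt0n.
have rq : ((m lj).+1 %% q < q)%N by rewrite ltn_mod.
have i0 : (0 < i)%N by rewrite /i; lia.
have iq : (i < q)%N by rewrite /i; lia.
have im : (i <= m ord0)%N by apply: leq_trans (dvdn_leq m0 qm0); lia.
pose A := (m lj + i)%N.
have qA : (q %| A.+1)%N.
  rewrite /A -addSn {1}(divn_eq (m lj).+1 q) -addnA /i subnKC ?(ltnW rq) //.
  by rewrite dvdn_add // dvdn_mull.
pose u : 'X_{1..n.+1} :=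
  [multinom if a == ord0 then (m ord0 - i)%N else
            if a == lj then 0%N else m a | a < n.+1].
have nlj : (lj == ord0) = false by [].
pose v l : 'X_{1..n.+1} := (u + U_(lj) *+ (A - l) + U_(ord0) *+ l)%MM.
have v0 l : v l ord0 = (m ord0 - i + l)%N.
  by rewrite /v !mnmDE !mulmnE !mnm1E mnmE eqxx nlj mul0n addn0 mul1n.
have vj l : v l lj = (A - l)%N.
  by rewrite /v !mnmDE !mulmnE !mnm1E mnmE eqxx nlj mul1n mul0n addn0.
have vE a l : a != ord0 -> a != lj -> v l a = m a.
  move=> a0 aj; rewrite /v !mnmDE !mulmnE !mnm1E mnmE (negPf a0) (negPf aj).
  by rewrite !(eq_sym _ a) (negPf a0) (negPf aj) !mul0n !addn0.
have vi : v i = m.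
  apply/mnmP => a; have [->|a0] := eqVneq a ord0; first by rewrite v0 subnK.
  have [->|aj] := eqVneq a lj; first by rewrite vj /A addnK.
  by rewrite vE.
have dv l : (l <= A)%N -> mdeg (v l) = mdeg m.
  move=> lA; rewrite -vi /v !mdegD !mdegMn !mdeg1 /A; lia.
pose f : {mpoly F[n.+1]} := 'X_[v 0%N].
have f_homog : f \is (mdeg m).-homog by rewrite dhomogX /= dv.
have actf c : act (transv c) f =
    \sum_(l < A.+1) ('C(A, l)%:R * c ^+ l) *: 'X_[v l].
  have -> : act (transv c) f = 'X_[u] * ('X_lj + c *: 'X_(@ord0 n)) ^+ A.
    rewrite /f /v mulm0n addm0 subn0 mpolyXD rmorphM /= -mpolyXn rmorphXn /=.
    rewrite act_transvX eqxx mulr1n; congr (_ * _).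
    rewrite /act sbstXm [RHS]mpolyXE_id; apply: eq_bigr => a _.
    rewrite -actX act_transvX; have [->|_] := eqVneq a lj.
      by rewrite mnmE nlj eqxx !expr0.
    by rewrite mulr0n scale0r addr0.
  rewrite exprDn mulr_sumr; apply: eq_bigr => l _.
  rewrite exprZn /v !mpolyXD -!mpolyXn -scaler_nat -!scalerAr scalerA.
  by rewrite mulrA.
pose k l : F := 'C(A, l)%:R * \sum_(c : F) c ^+ (q.-1 - i + l).
have R : rel (mdeg m) (\sum_(l < A) k l.+1 *: 'X_[v l.+1]).
  have /(_ _)/wrap[] := @rel_sum F n.+1 (mdeg m) _ (index_enum F) predT
    (fun c => c ^+ (q.-1 - i) *: (act (transv c) f - f)).
    by move=> c _; apply/relZ/rel_act => //; apply: transv_uptri.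
  congr rel; transitivity (\sum_(c : F) \sum_(l < A)
      (c ^+ (q.-1 - i) * ('C(A, l.+1)%:R * c ^+ l.+1)) *: ('X_[v l.+1] : {mpoly F[n.+1]})).
    apply: eq_bigr => c _; rewrite actf big_ord_recl /= bin0 mul1r expr0 scale1r.
    rewrite addrAC subrr add0r scaler_sumr; apply: eq_bigr => l _.
    by rewrite scalerA.
  rewrite exchange_big /=; apply: eq_bigr => l _; rewrite -scaler_suml.
  congr (_ *: _); rewrite /k mulr_sumr; apply: eq_bigr => c _.
  by rewrite mulrCA exprD.
have iA : (i.-1 < A)%N by rewrite /A; lia.
have ki : k i != 0.
  rewrite /k bin_predq // subnK; last by lia.
  by rewrite sum_expf_predq mulf_neq0 ?signr_eq0 // oppr_eq0 oner_eq0.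
rewrite (bigD1 (Ordinal iA)) //= prednK // vi in R.
(* For [l < i] the power sum has an exponent strictly between [0] and [q - 1];
   for [l > i] the monomial has a higher power of [x_0]. *)
have S : spanned (mdeg m) (\sum_(l < A | l != Ordinal iA)
    k l.+1 *: ('X_[v l.+1] : {mpoly F[n.+1]})).
  apply: spanned_sum => l li.
  have {}li : (l.+1 != i)%N.
    by apply: contra li => /eqP li; apply/eqP/val_inj => /=; rewrite -li.
  case: (ltngtP l.+1 i) li => // li _; last first.
    apply: spannedZ; apply: H; first by rewrite dv.
    by rewrite v0; lia.
  rewrite /k sum_expf_small; last by lia.
  by rewrite mulr0 scale0r; apply: spanned0.
have -> : 'X_[m] = (k i)^-1 *: ((k i *: 'X_[m] +
    \sum_(l < A | l != Ordinal iA) k l.+1 *: 'X_[v l.+1]) +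
    (-1) *: \sum_(l < A | l != Ordinal iA) k l.+1 *: ('X_[v l.+1] : {mpoly F[n.+1]})).
  by rewrite scaleN1r addrK scalerA mulVf ?scale1r.
by apply/spannedZ/spannedD/spannedZ/S; apply: spanned_rel.
Qed.

End Transvection.
End Upper.

(** * Good monomials span *)

Section UpperBound.
Variable F : finFieldType.
Local Notation q := #|F|.

Section Tail.
Variable n : nat.
Implicit Types (f : {mpoly F[n]}) (m : 'X_{1..n}) (s : 'M[F]_n).

Definition shift : {mpoly F[n]} -> {mpoly F[n.+1]} :=
  sbst (fun j => 'X_(lift ord0 j)).
HB.instance Definition _ := GRing.RMorphism.on shift.
HB.instance Definition _ := GRing.Linear.on shift.

Definition frob : {mpoly F[n]} -> {mpoly F[n]} := sbst (fun j => 'X_j ^+ q).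
HB.instance Definition _ := GRing.Linear.on frob.

Lemma shiftXm k m : 'X_(@ord0 n) ^+ k * shift 'X_[m] = 'X_[mcons k m].
Proof.
rewrite /shift sbstXm [RHS]mpolyXE_id big_ord_recl mcons0; congr (_ * _).
by apply: eq_bigr => j _; rewrite mconsS.
Qed.

Lemma frobXm m : frob 'X_[m] = 'X_[m *+ q].
Proof.
rewrite /frob sbstXm [RHS]mpolyXE_id; apply: eq_bigr => j _.
by rewrite mulmnE -exprM mulnC.
Qed.

Lemma shift_homog f d : f \is d.-homog -> shift f \is d.-homog.
Proof.
rewrite -{2}[d]mul1n; apply: sbst_homog => j.
by rewrite dhomogX /= mdeg1.
Qed.

Lemma frob_homog f d : f \is d.-homog -> frob f \is (q * d).-homog.
Proof.
apply: sbst_homog => j; rewrite -[q in X in X.-homog]mul1n; apply: dhomogMn.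
by rewrite dhomogX /= mdeg1.
Qed.

Lemma act_frob s f : act s (frob f) = frob (act s f).
Proof.
rewrite /frob act_sbst sbst_act; apply: eq_sbst => j.
by rewrite rmorphXn /= actX sum_exprq.
Qed.

Definition cornered_mx s : 'M[F]_n.+1 := \matrix_(a, b)
  consf (consf 1 (fun=> 0) b) (fun i => consf 0 (s i) b) a.

Lemma cornered_mx_uptri s : uptri s -> uptri (cornered_mx s).
Proof.
move=> /uptriP[d u]; apply/uptriP; split; apply: ordP => [|i].
- by rewrite mxE !consf0 oner_neq0.
- by rewrite mxE !consfS.
- by move=> b.
apply: ordP => [_|j ij]; first by rewrite mxE consfS consf0.
by rewrite mxE !consfS u.
Qed.

Lemma act_cornered_mxX0 s : act (cornered_mx s) 'X_(@ord0 n) = 'X_(@ord0 n).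
Proof.
rewrite actX big_ord_recl mxE !consf0 scale1r big1 ?addr0 // => i _.
by rewrite mxE consfS consf0 scale0r.
Qed.

Lemma act_shift s f : act (cornered_mx s) (shift f) = shift (act s f).
Proof.
rewrite /shift act_sbst sbst_act; apply: eq_sbst => j.
rewrite actX big_ord_recl mxE consf0 consfS scale0r add0r.
by apply: eq_bigr => i _; rewrite mxE !consfS.
Qed.

(** These polynomials represent what survives of [x_0^k F[x_1, ..., x_n]]
    modulo relations and higher powers of [x_0]; the [q]-th powers make them
    transform under [s] like [f] itself. *)
Definition lead k f : {mpoly F[n.+1]} :=
  'X_(@ord0 n) ^+ k * shift ('X_[topm F n] * frob f).

Fact lead_is_linear k : linear (lead k).
Proof.
move=> c f g; rewrite /lead linearP mulrDr -scalerAr linearP mulrDr.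
by rewrite -scalerAr.
Qed.
HB.instance Definition _ k := GRing.isLinear.Build F {mpoly F[n]}
  {mpoly F[n.+1]} _ (lead k) (lead_is_linear k).

Lemma leadXm k m : lead k 'X_[m] = 'X_[mcons k (topm F n + m *+ q)].
Proof. by rewrite /lead frobXm -mpolyXD shiftXm. Qed.

Lemma lead_homog k f d : f \is d.-homog ->
  lead k f \is (k + (n * q.-1 + q * d)).-homog.
Proof.
move=> hf; apply: dhomogM.
  rewrite -[X in X.-homog]mul1n; apply: dhomogMn.
  by rewrite dhomogX /= mdeg1.
apply: shift_homog; apply: dhomogM; last exact: frob_homog.
by rewrite dhomogX /= mdeg_topm.
Qed.

Lemma good_lead k m : (0 < k)%N -> (q.-1 %| k)%N -> good F m ->
  good F (mcons k (topm F n + m *+ q)%MM).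
Proof.
move=> k0 qk gm; rewrite /= mcons0 mtail_cons; apply/orP; right.
rewrite k0 qk /=; apply/andP; split.
  apply/forallP => j; rewrite mnmDE mulmnE mnmE -addSn prednK ?card_gt0 //.
  by rewrite dvdn_add ?dvdn_mull.
rewrite (_ : [multinom _ | _ < _] = m) //; apply/mnmP => j.
rewrite mnmE mnmDE mulmnE mnmE addnC divnMDl ?card_gt0 //.
by rewrite divn_small ?addn0 // ltn_predL card_gt0.
Qed.

Lemma good_shift m : good F (mcons 0 m) = good F m.
Proof. by rewrite /= mcons0 mtail_cons eqxx /= orbF. Qed.

End Tail.

Lemma act_top_homog n (s : 'M[F]_n) :
  act s 'X_[topm F n] - 'X_[topm F n] \is (n * q.-1).-homog.
Proof. by rewrite rpredB ?act_homog // dhomogX /= mdeg_topm. Qed.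

(** The only monomial of degree [n (q - 1)] with all exponents [-1] modulo [q]
    is [x^(q-1,...,q-1)], and its coefficient is invariant. *)
Lemma msupp_act_top n (s : 'M[F]_n) (u : 'X_{1..n}) : uptri s ->
  u \in msupp (act s 'X_[topm F n] - 'X_[topm F n]) ->
  exists j, ~~ (q %| (u j).+1)%N.
Proof.
move=> us uh.
have [j uj|no] := pickP (fun j => ~~ (q %| (u j).+1)%N); first by exists j.
have du : mdeg u = (n * q.-1)%N.
  exact: (dhomog_mf (act_top_homog s) uh).
have le j : (q.-1 <= u j)%N.
  have /dvdn_leq : (q %| (u j).+1)%N by apply: contraFT (no j).
  by move=> /(_ isT); case: q.
have uT := eq_topm du le.
move: uh; rewrite uT mcoeff_msupp mcoeffB mcoeff_top_act ?uptri_unit //.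
  by rewrite subrr eqxx.
by rewrite dhomogX /= mdeg_topm.
Qed.

(** The outer induction is on the number of variables, the inner one descends
    on the exponent of [x_0], which is bounded by the degree. *)
Theorem good_span n d (p : {mpoly F[n]}) : p \is d.-homog -> spanned d p.
Proof.
elim: n d p => [|n IH] d p hp.
  by exists p; split; rewrite ?subrr //; apply: Rel0.
suff main (m : 'X_{1..n.+1}) : mdeg m = d -> spanned d ('X_[F, m]).
  rewrite [p]mpolyE big_seq; apply: spanned_sum => m /(dhomog_mf hp) /= dm.
  exact/spannedZ/main.
have [e le_e] := ubnP (d - m ord0); elim: e m le_e => // e IHe m le_e dm.
have H (m' : 'X_{1..n.+1}) : mdeg m' = d -> (m ord0 < m' ord0)%N ->
    spanned d ('X_[F, m']).
  move=> dm' lt; apply: IHe => //.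
  have : (m' ord0 <= d)%N by rewrite -dm' mdeg_tail leq_addr.
  by lia.
have [m0|m0] := posnP (m ord0).
  have dt : mdeg (mtail m) = d by rewrite -dm mdeg_tail m0.
  have [|w [gw rw]] := IH d 'X_[mtail m]; first by rewrite dhomogX /= dt.
  have -> : 'X_[m] = shift 'X_[mtail m] :> {mpoly F[n.+1]}.
    by rewrite -[LHS]mul1r -{1}[m]mcons_tail m0 -shiftXm expr0 !mul1r.
  have -> : 'X_[mtail m] = ('X_[mtail m] - w) + w :> {mpoly F[n]} by rewrite subrK.
  rewrite linearD; apply: spannedD.
    apply: spanned_rel; elim: rw => [|r s f _ IHr us fd]; first by rewrite linear0; apply: Rel0.
    rewrite linearD linearB /= -act_shift; apply: RelS IHr _ _.
      exact: cornered_mx_uptri.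
    exact: shift_homog.
  apply: spanned_linear => v /gw gv /=.
  rewrite -[shift _]mul1r -(expr0 'X_(@ord0 n)) shiftXm; apply: spanned_good.
  by rewrite good_shift.
have [qm0|qm0] := boolP (q.-1 %| m ord0)%N; last first.
  by rewrite -dm; apply/spanned_rel/rel_torus/qm0.
(* Monomials with some exponent not congruent to [-1] modulo [q] reduce to
   higher powers of [x_0]. *)
have low (m' : 'X_{1..n.+1}) : mdeg m' = d -> m' ord0 = m ord0 ->
    (exists j, ~~ (q %| (mtail m' j).+1)%N) -> spanned d ('X_[F, m']).
  move=> dm' e0 [j]; rewrite mnmE => ej; rewrite -dm'.
  by apply: (spanned_transv _ _ ej); rewrite e0 // dm'.
have [j qj|no] := pickP (fun j => ~~ (q %| (mtail m j).+1)%N).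
  by apply: low => //; exists j.
pose b := [multinom (mtail m j %/ q)%N | j < n].
have tE : mtail m = (topm F n + b *+ q)%MM.
  by apply: topm_divn => j; apply: contraFT (no j).
have [|w [gw rw]] := IH (mdeg b) 'X_[b]; first by rewrite dhomogX /=.
have dE : d = (m ord0 + (n * q.-1 + q * mdeg b))%N.
  have := @lead_homog n (m ord0) 'X_[b] (mdeg b); rewrite dhomogX eqxx => /(_ isT).
  by rewrite leadXm -tE mcons_tail dhomogX /= dm => /eqP.
have -> : 'X_[m] = lead (m ord0) 'X_[b] :> {mpoly F[n.+1]}.
  by rewrite leadXm -tE mcons_tail.
have -> : 'X_[b] = ('X_[b] - w) + w :> {mpoly F[n]} by rewrite subrK.
rewrite linearD; apply: spannedD; last first.
  apply: spanned_linear => v /gw gv /=; rewrite leadXm; apply: spanned_good.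
  exact: good_lead.
elim: rw => [|r s f _ IHr us fd]; first by rewrite linear0; apply: spanned0.
rewrite linearD; apply: spannedD IHr _; rewrite linearB.
(* The action on [lead k f] differs from [lead k (s f)] only by monomials with
   some exponent not [-1] modulo [q]. *)
pose g := act s f; pose h := act s 'X_[topm F n] - 'X_[topm F n].
have -> : lead (m ord0) g - lead (m ord0) f =
    (act (cornered_mx s) (lead (m ord0) f) - lead (m ord0) f) -
    'X_(@ord0 n) ^+ m ord0 * shift (h * frob g).
  rewrite /lead [act (cornered_mx s) _]rmorphM /= rmorphXn /= act_cornered_mxX0 act_shift.
  rewrite [act s _]rmorphM /= act_frob -/g.
  rewrite addrAC; congr (_ - _).
  by rewrite -mulrBr -rmorphB /= -mulrBl opprB addrCA subrr addr0.
apply: spannedD.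
  apply/spanned_rel/rel_act; first exact: cornered_mx_uptri.
  by rewrite dE; apply: lead_homog.
rewrite -scaleN1r; apply: spannedZ.
have gd : g \is (mdeg b).-homog by apply: act_homog.
have hd : h \is (n * q.-1).-homog by apply: act_top_homog.
rewrite {1}[h]mpolyE mulr_suml linear_sum mulr_sumr big_seq.
apply: spanned_sum => u uh; have [j uj] := msupp_act_top us uh.
rewrite -scalerAl linearZ /= -scalerAr; apply: spannedZ.
rewrite {1}[g]mpolyE linear_sum [X in shift X]mulr_sumr linear_sum mulr_sumr big_seq.
apply: spanned_sum => v vg; rewrite linearZ /= -scalerAr linearZ /= -scalerAr.
apply: spannedZ; rewrite frobXm -mpolyXD shiftXm.
apply: low; rewrite ?mcons0 ?mdeg_cons ?mtail_cons //.
  by rewrite mdegD mdegMn (dhomog_mf hd uh) (dhomog_mf gd vg) (mulnC (mdeg b)) -dE.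
by exists j; rewrite mnmDE mulmnE -addSn dvdn_addl // dvdn_mull.
Qed.

End UpperBound.

(** * The trace in one variable *)

Section OneVariable.
Variable F : finFieldType.
Local Notation q := #|F|.

Lemma sum_XaddC_expn a : (a < q)%N ->
  \sum_(c : F) ('X + c%:P) ^+ a = - (q %| a.+1)%:R%:P.
Proof.
move=> aq; under eq_bigr => c _ do rewrite exprDn.
rewrite exchange_big /= big_ord_recr /= subnn expr0 big1 ?add0r => [|l _].
  under eq_bigr => c _ do rewrite mul1r binn mulr1n -rmorphXn /=.
  rewrite -rmorph_sum -rmorphN /=; congr (_%:P).
  have [e|ne] := eqVneq a.+1 q.
    have -> : a = q.-1 by rewrite -e.
    by rewrite sum_expf_predq prednK ?card_gt0 // dvdnn.
  have lt : (a.+1 < q)%N by rewrite ltn_neqAle ne.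
  rewrite sum_expf_small; last by lia.
  by rewrite gtnNdvd // oppr0.
under eq_bigr => c _ do rewrite -rmorphXn -mulrnAr -rmorphMn.
rewrite -mulr_sumr -rmorph_sum sumrMnl /= sum_expf_small ?mul0rn ?mulr0 //.
by have := ltn_ord l; lia.
Qed.

(** The trace over the translations [x |-> x + c] is a polynomial in
   [x^q - x], because [(x + c)^(a + q)] equals [(x + c)^(a + 1)] plus
   [(x^q - x) (x + c)^a]; the same recursion controls its leading term. *)
Lemma trace_poly_exists a : exists T : {poly F},
  (\sum_(c : F) ('X + c%:P) ^+ a == - (T \Po ('X^q - 'X))) &&
  (size (T - (q %| a.+1)%:R *: 'X^(a %/ q))%R <= a %/ q)%N.
Proof.
have q1 := card_gt1 F; have q0 := card_gt0 F.
have [e le_e] := ubnP a; elim: e a le_e => // e IH a le_e.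
have [aq|qa] := ltnP a q.
  exists ((q %| a.+1)%:R%:P); rewrite sum_XaddC_expn // comp_polyC eqxx /=.
  by rewrite divn_small // expr0 -mul_polyC mulr1 subrr size_poly0.
have [b ab] : {b | a = (b + q)%N} by exists (a - q)%N; rewrite subnK.
have [|T1 /andP[/eqP e1 s1]] := IH b.+1; first by lia.
have [|T0 /andP[/eqP e0 s0]] := IH b; first by lia.
exists (T1 + 'X * T0); apply/andP; split.
  rewrite comp_polyD comp_polyM comp_polyX opprD -e1 -mulrN -e0 mulr_sumr.
  rewrite -big_split /=; apply/eqP/eq_bigr => c _.
  rewrite ab exprD exprDq -rmorphXn /= expf_card exprS; ring.
have -> : (a %/ q = (b %/ q).+1)%N by rewrite ab divnDr ?dvdnn // divnn q0 addn1.
have -> : (q %| a.+1)%N = (q %| b.+1)%N by rewrite ab -addSn dvdn_addl.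
have -> : T1 + 'X * T0 - (q %| b.+1)%:R *: 'X^((b %/ q).+1) =
    T1 + 'X * (T0 - (q %| b.+1)%:R *: 'X^(b %/ q)).
  by rewrite mulrBr -scalerAr -exprS addrA.
apply: leq_trans (size_polyD _ _) _; rewrite geq_max; apply/andP; split.
  rewrite -[T1](subrK ((q %| b.+2)%:R *: 'X^(b.+1 %/ q))).
  apply: leq_trans (size_polyD _ _) _; rewrite geq_max; apply/andP; split.
    apply: leq_trans s1 _; rewrite -addn1 -[X in (_ <= X)%N]addn1.
    by apply: leq_trans (leq_div2r _ (leq_add (leqnn b) (ltnW q1))) _;
       rewrite divnDr ?dvdnn // divnn q0.
  have [qb|] := boolP (q %| b.+2)%N; last by rewrite scale0r size_poly0.
  rewrite scale1r size_polyXn ltnS; case/dvdnP: qb => k ek.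
  have k0 : (0 < k)%N by case: k ek.
  have -> : b = (k.-1 * q + (q - 2))%N by nia.
  by rewrite -addnS !divnMDl // !divn_small ?addn0; lia.
have [->|nz] := eqVneq (T0 - (q %| b.+1)%:R *: 'X^(b %/ q)) 0.
  by rewrite mulr0 size_poly0.
by rewrite mulrC size_mulX.
Qed.

Definition trace_poly a : {poly F} := xchoose (trace_poly_exists a).

Lemma trace_polyE a :
  \sum_(c : F) ('X + c%:P) ^+ a = - (trace_poly a \Po ('X^q - 'X)).
Proof. by case/andP: (xchooseP (trace_poly_exists a)) => /eqP. Qed.

Lemma size_trace_poly b :
  (size (trace_poly (q.-1 + b * q) - 'X^b)%R <= b)%N.
Proof.
case/andP: (xchooseP (trace_poly_exists (q.-1 + b * q))) => _.
rewrite -/(trace_poly _).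
rewrite -addSn prednK ?card_gt0 // dvdn_addl ?dvdn_mull // dvdnn scale1r.
by rewrite addnC divnMDl ?card_gt0 // divn_small ?addn0 // ltn_predL card_gt0.
Qed.

Lemma horner_alg_comp (A : comAlgType F) (x : A) (p r : {poly F}) :
  horner_alg x (p \Po r) = horner_alg (horner_alg x r) p.
Proof.
elim/poly_ind: p => [|p c IH]; first by rewrite comp_poly0 !rmorph0.
rewrite comp_polyD comp_polyM comp_polyX comp_polyC !rmorphD !rmorphM /= IH.
by rewrite horner_algX !horner_algC.
Qed.

Lemma sum_exp_trace (A : comAlgType F) (x : A) a :
  \sum_(c : F) (x + c%:A) ^+ a = - horner_alg (x ^+ q - x) (trace_poly a).
Proof.
have := congr1 (horner_alg x) (trace_polyE a).
rewrite rmorphN /= horner_alg_comp rmorphB rmorphXn /= horner_algX => <-.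
rewrite rmorph_sum; apply: eq_bigr => c _ /=.
by rewrite rmorphXn rmorphD /= horner_algX horner_algC.
Qed.

End OneVariable.

(** * Leading terms *)

Section Leading.
Variables (F : finFieldType) (n : nat).
Local Notation q := #|F|.
Implicit Types x y : {mpoly F[n]}.

(** Agreement of leading parts; recording the degree [d] to which they are
    attached makes the relation compatible with products. *)
Definition close d x y := (msize y <= d.+1)%N /\ (msize (x - y)%R <= d)%N.

Lemma msizeM_leq x y : (msize (x * y) <= (msize x + msize y).-1)%N.
Proof.
have [->|x0] := eqVneq x 0; first by rewrite mul0r msize0.
have [->|y0] := eqVneq y 0; first by rewrite mulr0 msize0.
by rewrite msizeM.
Qed.

Lemma close1 : close 0 1 1.
Proof. by rewrite /close msize1 subrr msize0. Qed.

Lemma closeM d d' x y x' y' :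
  close d x y -> close d' x' y' -> close (d + d') (x * x') (y * y').
Proof.
move=> [sy sxy] [sy' sxy']; split.
  by apply: leq_trans (msizeM_leq _ _) _; lia.
have -> : x * x' - y * y' = (x - y) * (x' - y') + ((x - y) * y' + y * (x' - y')).
  by ring.
apply: leq_trans (msizeD_le _ _) _; rewrite geq_max; apply/andP; split.
  by apply: leq_trans (msizeM_leq _ _) _; lia.
apply: leq_trans (msizeD_le _ _) _; rewrite geq_max; apply/andP; split.
  by apply: leq_trans (msizeM_leq _ _) _; lia.
by apply: leq_trans (msizeM_leq _ _) _; lia.
Qed.

Lemma closeX d x y k : close d x y -> close (d * k) (x ^+ k) (y ^+ k).
Proof.
move=> c; elim: k => [|k IH]; first by rewrite muln0; apply: close1.
by rewrite mulnS !exprS; apply: closeM.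
Qed.

Lemma close_prod (I : Type) (r : seq I) (d : I -> nat)
    (x y : I -> {mpoly F[n]}) :
  (forall i, close (d i) (x i) (y i)) ->
  close (\sum_(i <- r) d i) (\prod_(i <- r) x i) (\prod_(i <- r) y i).
Proof.
move=> H; elim: r => [|i r IH]; first by rewrite !big_nil; apply: close1.
by rewrite !big_cons; apply: closeM.
Qed.

Lemma close_coef d x y m : close d x y -> mdeg m = d -> x@_m = y@_m.
Proof.
move=> [_ s] dm; apply/eqP; rewrite -subr_eq0 -mcoeffB; apply/eqP.
by apply/memN_msupp_eq0/msize_mdeg_ge; rewrite dm.
Qed.

Lemma close_coef0 d x y m : close d x y -> (d < mdeg m)%N -> x@_m = 0.
Proof.
move=> [sy s] dm; apply/memN_msupp_eq0/msize_mdeg_ge.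
rewrite -[x](subrK y); apply: leq_trans (msizeD_le _ _) _.
by rewrite geq_max (leq_trans s (ltnW dm)) (leq_trans sy dm).
Qed.

Lemma msize_sum_le (I : Type) (r : seq I) (E : I -> {mpoly F[n]}) k :
  (forall i, msize (E i) <= k)%N -> (msize (\sum_(i <- r) E i) <= k)%N.
Proof.
move=> H; apply: (big_ind (fun p : {mpoly F[n]} => msize p <= k)%N) => //.
  by rewrite msize0.
by move=> x y sx sy; apply: leq_trans (msizeD_le _ _) _; rewrite geq_max sx.
Qed.

Lemma msize_horner_alg j (p : {poly F}) :
  (msize (horner_alg ('X_j : {mpoly F[n]}) p) <= size p)%N.
Proof.
rewrite -{1}[p]coefK poly_def linear_sum; apply: msize_sum_le => i /=.
rewrite linearZ rmorphXn /= horner_algX mulr_algl; apply: leq_trans (msizeZ_le _ _) _.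
by rewrite mpolyXn msizeX mdegMn mdeg1 mul1n.
Qed.

Lemma close_trace j b :
  close b (horner_alg 'X_j (trace_poly F (q.-1 + b * q))) ('X_j ^+ b).
Proof.
split; first by rewrite mpolyXn msizeX mdegMn mdeg1 mul1n.
have -> : 'X_j ^+ b = horner_alg ('X_j : {mpoly F[n]}) 'X^b.
  by rewrite rmorphXn /= horner_algX.
rewrite -rmorphB; apply: leq_trans (msize_horner_alg j _) _.
exact: size_trace_poly.
Qed.

End Leading.

(** * The Artin-Schreier substitution *)

Section ArtinSchreier.
Variables (F : finFieldType) (n : nat).
Local Notation q := #|F|.

Definition artin : {mpoly F[n]} -> {mpoly F[n]} :=
  sbst (fun j => 'X_j ^+ q - 'X_j).
HB.instance Definition _ := GRing.RMorphism.on artin.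
HB.instance Definition _ := GRing.Linear.on artin.

Lemma close_artin (a : 'X_{1..n}) : close (q * mdeg a) (artin 'X_[a]) 'X_[a *+ q].
Proof.
rewrite /artin sbstXm mpolyXE_id mdegE big_distrr /=; apply: close_prod => j.
rewrite mulmnE (mulnC (a j)) exprM; apply: closeX; split.
  by rewrite mpolyXn msizeX mdegMn mdeg1 mul1n.
by rewrite addrAC subrr add0r msizeN msizeX mdeg1 card_gt1.
Qed.

(** The leading monomial [m] of [p] contributes [q m], which no other monomial
    of [p] can reach. *)
Lemma artin_eq0 p : artin p = 0 -> p = 0.
Proof.
move=> p0; apply/eqP/contraT => nz; pose m := mlead p.
have : (artin p)@_(m *+ q) = p@_m.
  have -> := linear_mpolyE artin p.
  rewrite (raddf_sum (mcoeff _)) (bigD1_seq m) ?msupp_uniq ?mlead_supp //= mcoeffZ.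
  have dq (a : 'X_{1..n}) : mdeg (a *+ q) = (q * mdeg a)%N by rewrite mdegMn mulnC.
  have -> : (artin 'X_[m])@_(m *+ q) = 1.
    by rewrite (close_coef (close_artin m) (dq m)) mcoeffX eqxx.
  rewrite mulr1 big_seq_cond big1 ?addr0 // => a /andP[ap am].
  suff z : (artin 'X_[a])@_(m *+ q) = 0 by rewrite mcoeffZ z mulr0.
  have : (mdeg a <= mdeg m)%N by rewrite -ltnS mlead_deg // msize_mdeg_lt.
  rewrite leq_eqVlt => /orP[/eqP e|lt]; last first.
    apply: (close_coef0 (close_artin a)).
    by rewrite dq ltn_pmul2l ?card_gt0.
  rewrite (close_coef (close_artin a)) ?dq ?e // mcoeffX.
  case: eqP => // /mnmP eam; case/eqP: am; apply/mnmP => i.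
  have := eam i; rewrite !mulmnE => /eqP.
  by rewrite eqn_pmul2r ?card_gt0 // => /eqP.
by rewrite p0 mcoeff0 => /esym/eqP; rewrite mleadc_eq0 (negPf nz).
Qed.

Lemma artin_inj : injective artin.
Proof.
move=> x y e; apply/eqP; rewrite -subr_eq0; apply/eqP/artin_eq0.
by rewrite rmorphB /= e subrr.
Qed.

Lemma act_artin s f : act s (artin f) = artin (act s f).
Proof.
rewrite /artin act_sbst sbst_act; apply: eq_sbst => j.
rewrite rmorphB rmorphXn /= actX sum_exprq -sumrB.
by apply: eq_bigr => i _; rewrite scalerBr.
Qed.

Lemma pihomog_act_mpoly e (s : 'M[F]_n) p :
  pihomog mdeg e (act s p) = act s (pihomog mdeg e p).
Proof.
have pE := @pihomog_partitionE _ _ mdeg _ p (leqnn _).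
rewrite [in LHS]pE [in RHS]pE (linear_sum (act s)).
rewrite !(linear_sum (pihomog mdeg e)) (linear_sum (act s)).
apply: eq_bigr => i _; have hom := act_homog s (pihomogP mdeg i p).
have [<-|ne] := eqVneq (i : nat) e.
  by rewrite [LHS](pihomog_dE hom) [X in _ = _ X]pihomog_id.
rewrite [LHS](pihomog_ne0 ne hom).
by rewrite [X in _ = _ X](pihomog_ne0 ne (pihomogP mdeg i p)) linear0.
Qed.

End ArtinSchreier.

(** * Good monomials are independent *)

Section LowerBound.
Variable F : finFieldType.
Local Notation q := #|F|.

Lemma sbst_scale n k (c : F) (v : 'I_n -> {mpoly F[k]}) d p :
  p \is d.-homog -> sbst (fun i => c *: v i) p = c ^+ d *: sbst v p.
Proof.
move=> hp; rewrite !sbstE scaler_sumr !big_seq; apply: eq_bigr => m mp.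
rewrite scalerA mulrC -scalerA; congr (_ *: _).
under eq_bigr => i _ do rewrite exprZn.
by rewrite scaler_prod prodrXr -mdegE (dhomog_mf hp mp).
Qed.

Lemma act_scale n (c : F) (s : 'M[F]_n) d p :
  p \is d.-homog -> act (c *: s) p = c ^+ d *: act s p.
Proof.
move=> hp; rewrite /act -(sbst_scale _ _ hp); apply: eq_sbst => j.
by rewrite scaler_sumr; apply: eq_bigr => i _; rewrite mxE scalerA.
Qed.

Section Restrict.
Variable n : nat.
Implicit Types (p f : {mpoly F[n.+1]}) (s : 'M[F]_n.+1).

Definition lower_block s : 'M[F]_n :=
  \matrix_(i, j) s (lift ord0 i) (lift ord0 j).

Lemma lower_block_uptri s : uptri s -> uptri (lower_block s).
Proof.
by move=> /uptriP[d u]; apply/uptriP; split=> [i|i j ij]; rewrite mxE ?d // u.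
Qed.

Definition restr : {mpoly F[n.+1]} -> {mpoly F[n]} :=
  sbst (consf 0 (fun j => 'X_j)).
HB.instance Definition _ := GRing.Linear.on restr.

Lemma restr_act s f : uptri s -> restr (act s f) = act (lower_block s) (restr f).
Proof.
move=> /uptriP[_ u]; rewrite /restr sbst_act act_sbst; apply: eq_sbst => i.
case: (unliftP ord0 i) => [j ->|->]; rewrite big_ord_recl !consf0 scaler0 add0r.
  rewrite consfS actX; apply: eq_bigr => a _; by rewrite consfS mxE.
by rewrite linear0; apply: big1 => a _; rewrite u ?scale0r.
Qed.

Lemma restr_homog f d : f \is d.-homog -> restr f \is d.-homog.
Proof.
rewrite -{2}[d]mul1n; apply: sbst_homog; apply: ordP => [|j].
  by rewrite consf0 dhomog0.
by rewrite consfS dhomogX /= mdeg1.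
Qed.

Lemma rel_restr d p : rel d p -> rel d (restr p).
Proof.
elim=> [|r s f _ IH us fd]; first by rewrite linear0; apply: Rel0.
rewrite linearD linearB /= restr_act //; apply: RelS => //.
  exact: lower_block_uptri.
exact: restr_homog.
Qed.

Lemma restrXm (a : 'X_{1..n.+1}) :
  restr 'X_[a] = if a ord0 == 0%N then 'X_[mtail a] else 0.
Proof.
rewrite /restr sbstXm big_ord_recl consf0 expr0n.
case: eqP => _ /=; last by rewrite mul0r.
rewrite mul1r [RHS]mpolyXE_id; apply: eq_bigr => j _.
by rewrite consfS mnmE.
Qed.

Lemma mcoeff_restr p m : (restr p)@_m = p@_(mcons 0 m).
Proof.
have -> := linear_mpolyE restr p.
rewrite {3}[p]mpolyE !raddf_sum /=; apply: eq_bigr => a _.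
rewrite !mcoeffZ restrXm mcoeffX; congr (_ * _).
have -> : (a == mcons 0 m) = (a ord0 == 0%N) && (mtail a == m).
  apply/eqP/andP => [->|[/eqP a0 /eqP <-]].
    by rewrite mcons0 mtail_cons !eqxx.
  by rewrite -a0 mcons_tail.
by case: eqP => _; rewrite ?mcoeffX ?mcoeff0.
Qed.

Definition ev1 (c : {ffun 'I_n -> F}) : {mpoly F[n.+1]} -> {mpoly F[n]} :=
  sbst (consf 1 (fun j => 'X_j + (c j)%:A)).
HB.instance Definition _ c := GRing.Linear.on (ev1 c).

(** The trace over the unipotent radical [x_j |-> x_j + c_j x_0], with [x_0]
   specialised to [1], which loses nothing on homogeneous polynomials. *)
Definition trace p : {mpoly F[n]} := \sum_(c : {ffun 'I_n -> F}) ev1 c p.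

Fact trace_is_linear : linear trace.
Proof.
move=> a p r; rewrite /trace scaler_sumr -big_split /=.
by apply: eq_bigr => c _; rewrite linearP.
Qed.
HB.instance Definition _ := GRing.isLinear.Build F {mpoly F[n.+1]}
  {mpoly F[n]} _ trace trace_is_linear.

(** The trace of a monomial written in the variables [y_j = x_j^q - x_j], up to
    the sign [(-1)^n]; [x_j] stands for [y_j] here. *)
Definition resm (m : 'X_{1..n.+1}) : {mpoly F[n]} :=
  \prod_j horner_alg 'X_j (trace_poly F (mtail m j)).

Definition residue p : {mpoly F[n]} := \sum_(m <- msupp p) p@_m *: resm m.

Lemma artin_horner j (p : {poly F}) :
  artin (horner_alg 'X_j p) = horner_alg ('X_j ^+ q - 'X_j : {mpoly F[n]}) p.
Proof.
elim/poly_ind: p => [|p c IH]; first by rewrite !rmorph0.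
rewrite !rmorphD !rmorphM /= IH !horner_algX !horner_algC.
by rewrite [artin 'X_j]sbstX linearZ /= rmorph1.
Qed.

Lemma traceXm m : trace 'X_[m] = (-1) ^+ n *: artin (resm m).
Proof.
rewrite /trace; under eq_bigr => c _.
  rewrite /ev1 sbstXm big_ord_recl consf0 expr1n mul1r.
  under eq_bigr => j _ do rewrite consfS.
  over.
rewrite -(bigA_distr_bigA (fun j c => ('X_j + c%:A) ^+ m (lift ord0 j))) /=.
under eq_bigr => j _ do rewrite sum_exp_trace.
rewrite prodrN card_ord -[RHS]mulr_algl; congr (_ * _).
  by rewrite -in_algE rmorphXn rmorphN1.
rewrite /resm rmorph_prod; apply: eq_bigr => j _ /=.
by rewrite artin_horner mnmE.
Qed.

Lemma traceE p : trace p = (-1) ^+ n *: artin (residue p).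
Proof.
have -> := linear_mpolyE trace p.
have -> : artin (residue p) = \sum_(m <- msupp p) p@_m *: artin (resm m).
  rewrite /residue; have -> := linear_sum (@artin F n).
  by apply: eq_bigr => m _; rewrite linearZ.
rewrite scaler_sumr; apply: eq_bigr => m _.
by rewrite /= traceXm !scalerA mulrC.
Qed.

(** All properties of the residue come from those of the trace through this
    characterisation, which rests on the injectivity of [artin]. *)
Lemma residue_unique p r : trace p = (-1) ^+ n *: artin r -> residue p = r.
Proof.
rewrite traceE => /(congr1 (fun x => (-1) ^+ n *: x)); rewrite !scalerA.
rewrite -expr2 sqrr_sign !scale1r; exact: artin_inj.
Qed.

Lemma residueD p r : residue (p + r) = residue p + residue r.
Proof.
apply: residue_unique; have -> := linearD trace p r.
by rewrite /= !traceE rmorphD scalerDr.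
Qed.

Lemma residueN p : residue (- p) = - residue p.
Proof.
apply: residue_unique; have -> := linearN trace p.
by rewrite /= traceE rmorphN scalerN.
Qed.

Lemma residue0 : residue 0 = 0.
Proof. by rewrite /residue msupp0 big_nil. Qed.

(** A triangular [s] normalises the group of translations, so it permutes the
   terms of the trace. *)
Lemma trace_act s f d : uptri s -> f \is d.-homog ->
  trace (act s f) = (s ord0 ord0) ^+ d *:
    act ((s ord0 ord0)^-1 *: lower_block s) (trace f).
Proof.
move=> us hf; have [dg u] := uptriP _ us.
set a := s ord0 ord0; set t := a^-1 *: lower_block s.
have a0 : a != 0 by apply: dg.
pose h (c : {ffun 'I_n -> F}) : {ffun 'I_n -> F} :=
  [ffun j => a^-1 * (s ord0 (lift ord0 j) + \sum_i lower_block s i j * c i)].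
have E c : ev1 c (act s f) = a ^+ d *: act t (ev1 (h c) f).
  rewrite /ev1 sbst_act act_sbst -(sbst_scale _ _ hf); apply: eq_sbst => i.
  case: (unliftP ord0 i) => [j ->|->]; rewrite big_ord_recl !consf0; last first.
    rewrite rmorph1 big1 ?addr0 // => b _; by rewrite u ?scale0r.
  rewrite consfS linearD /= linearZ /= rmorph1 scalerDr actX.
  rewrite scalerA ffunE mulrA divff // mul1r scalerDl addrCA; congr (_ + _).
  rewrite scaler_suml scaler_sumr -big_split /=; apply: eq_bigr => b _.
  rewrite consfS !mxE scalerDr !scalerA; congr (_ *: _ + _).
  by rewrite mulrA divff // mul1r.
have hI : injective h.
  move=> c c' e; pose r (v : {ffun 'I_n -> F}) := \row_j v j.
  have ru := uptri_unit (lower_block_uptri us).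
  suff /rowP rE : r c = r c'.
    by apply/ffunP => j; have := rE j; rewrite !mxE.
  apply: (can_inj (mulmxK ru)); apply/rowP => j; rewrite mxE [RHS]mxE.
  have S v : \sum_i r v 0 i * lower_block s i j = \sum_i lower_block s i j * v i.
    by apply: eq_bigr => i _; rewrite mxE mulrC.
  have /ffunP/(_ j) := e; rewrite !ffunE => /(mulfI (invr_neq0 a0))/addrI e'.
  by rewrite !S.
rewrite /trace (eq_bigr _ (fun c _ => E c)) -scaler_sumr; congr (_ *: _).
have -> := linear_sum (act t); rewrite [RHS](reindex_inj hI) /=.
exact: eq_bigr.
Qed.

Lemma residue_act s f d : uptri s -> f \is d.-homog ->
  residue (act s f) = (s ord0 ord0) ^+ d *:
    act ((s ord0 ord0)^-1 *: lower_block s) (residue f).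
Proof.
move=> us hf; apply: residue_unique; rewrite (trace_act us hf) traceE.
rewrite [act _ (_ *: _)]linearZ /= act_artin.
by rewrite [artin (_ *: _)]linearZ /= !scalerA mulrC.
Qed.

(** On the part of degree [e] the residue is equivariant up to the scalar
    [s_00^(d - e)], which is [1] when [q - 1] divides [d - e]. *)
Lemma rel_residue d e p : (e <= d)%N -> (q.-1 %| d - e)%N -> rel d p ->
  rel e (pihomog mdeg e (residue p)).
Proof.
move=> ed qde; elim=> [|r s f _ IH us fd].
  by rewrite residue0 linear0; apply: Rel0.
have [dg _] := uptriP _ us.
rewrite !residueD residueN (residue_act us fd) !linearD linearN /=.
rewrite linearZ /= pihomog_act_mpoly (act_scale _ _ (pihomogP mdeg e _)).
rewrite scalerA exprVn -[in X in X / _](subnK ed) exprD mulfK ?expf_neq0 //.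
rewrite expf_dvd // scale1r; apply: RelS IH _ (pihomogP mdeg e _).
exact: lower_block_uptri.
Qed.

End Restrict.

Lemma good_inv n (m : 'X_{1..n.+1}) : good F m -> (0 < m ord0)%N ->
  (q.-1 %| m ord0)%N /\ exists2 b : 'X_{1..n}, good F b &
    mtail m = (topm F n + b *+ q)%MM.
Proof.
move=> gm m0; move: gm; rewrite /= eqn0Ngt m0 /=.
case/and3P => qm /forallP qj gb; split=> //.
exists [multinom (mtail m j %/ q)%N | j < n] => //; exact: topm_divn.
Qed.

Lemma close_resm n (m : 'X_{1..n.+1}) (b : 'X_{1..n}) :
  mtail m = (topm F n + b *+ q)%MM -> close (mdeg b) (resm m) 'X_[b].
Proof.
move=> mb; rewrite mpolyXE_id mdegE /resm mb; apply: close_prod => j.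
by rewrite mnmDE mulmnE mnmE; apply: close_trace.
Qed.

Lemma mcoeff_pihomog n e (p : {mpoly F[n]}) (m : 'X_{1..n}) :
  (pihomog mdeg e p)@_m = if mdeg m == e then p@_m else 0.
Proof.
rewrite pihomogE [in RHS](mpolyE p) !raddf_sum /= big_mkcond /=.
case: ifP => em; last first.
  apply: big1 => a _; case: ifP => // ea; rewrite mcoeffZ mcoeffX.
  by case: eqP => [am|_]; [rewrite -am ea in em | rewrite mulr0].
apply: eq_bigr => a _; case: ifPn => // ea; rewrite mcoeffZ mcoeffX.
by case: eqP => [am|_]; [rewrite am em in ea | rewrite mulr0].
Qed.

Lemma act_mpoly0 (s : 'M[F]_0) f : act s f = f.
Proof. by rewrite -[RHS]sbst_id /act; apply: eq_sbst => -[]. Qed.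

(** Restriction to [x_0 = 0] shows that a relation between good monomials has no
    part free of [x_0]; its part of lowest degree in [x_0] is then read off the
    part of highest degree of the residue. *)
Theorem good_free n d (p : {mpoly F[n]}) :
  rel d p -> {subset msupp p <= @good F n} -> p = 0.
Proof.
elim: n d p => [|n IH] d p rp gp.
  by elim: rp {gp} => // r s f _ -> _ _; rewrite act_mpoly0 subrr addr0.
have pd := rel_homog rp.
suff main k (m : 'X_{1..n}) : p@_(mcons k m) = 0.
  by apply/mpolyP => m; rewrite mcoeff0 -[m]mcons_tail main.
have [K ltK] := ubnP k; elim: K k m ltK => // K IHK k m ltK.
have [->|k0] := posnP k.
  have -> : p@_(mcons 0 m) = (restr p)@_m by rewrite mcoeff_restr.
  suff -> : restr p = 0 by rewrite mcoeff0.
  apply: (IH d); first exact: rel_restr.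
  move=> m'; rewrite mcoeff_msupp mcoeff_restr -mcoeff_msupp => /gp gm.
  by rewrite -[_ \in _]/(good F m') -good_shift.
apply/eqP/contraT; rewrite -mcoeff_msupp => mp.
have [|qk [b gb]] := good_inv (gp _ mp); first by rewrite mcons0.
rewrite mcons0 in qk; rewrite mtail_cons => mb; pose e := mdeg b.
have dE : d = (k + (n * q.-1 + q * e))%N.
  by rewrite -(dhomog_mf pd mp) /= mdeg_cons mb mdeg_top.
have q0 := card_gt0 F.
have ed : (e <= d)%N by rewrite dE; nia.
have qde : (q.-1 %| d - e)%N.
  have -> : (d - e = k + (n * q.-1 + q.-1 * e))%N by rewrite dE; nia.
  by apply: dvdn_add => //; apply: dvdn_add; [apply: dvdn_mull|apply: dvdn_mulr].
(* A monomial of [p] with a larger exponent of [x_0] has a residue of degree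
   less than [e]; one with exponent [k] contributes a single monomial in degree
   [e]. *)
have top (b' : 'X_{1..n}) : mdeg b' = e ->
    (residue p)@_b' = p@_(mcons k (topm F n + b' *+ q)%MM).
  move=> eb'; rewrite [in RHS](mpolyE p) /residue !raddf_sum /=.
  rewrite big_seq [RHS]big_seq; apply: eq_bigr => a ap.
  rewrite !mcoeffZ mcoeffX; congr (_ * _).
  have ka : (k <= a ord0)%N.
    rewrite leqNgt; apply/negP => lt; move: ap; rewrite mcoeff_msupp.
    by rewrite -[a]mcons_tail IHK ?eqxx //; apply: leq_trans lt _.
  have [_ [c gc ac]] := good_inv (gp _ ap) (leq_trans k0 ka).
  have da : d = (a ord0 + (n * q.-1 + q * mdeg c))%N.
    by rewrite -(dhomog_mf pd ap) /= mdeg_tail ac mdeg_top.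
  have cl := close_resm ac.
  have [ec|ne] := eqVneq (mdeg c) e.
    have a0 : a ord0 = k by move: da; rewrite dE ec; lia.
    rewrite (close_coef cl) ?ec ?eb' // mcoeffX; congr (_%:R).
    congr nat_of_bool; apply/eqP/eqP => [<-|].
      by rewrite -ac -a0 mcons_tail.
    by move=> /(congr1 (@mtail n)); rewrite mtail_cons ac => /topD_inj.
  rewrite (close_coef0 cl).
    case: eqP => // ae; case/eqP: ne; rewrite ae mcons0 dE in da.
    by nia.
  rewrite eb' ltn_neqAle ne /=; rewrite dE in da.
  by nia.
have fe : pihomog mdeg e (residue p) = 0.
  apply: IH (rel_residue ed qde rp) _ => b' bf.
  have eb' := dhomog_mf (pihomogP mdeg e (residue p)) bf.
  move: bf; rewrite mcoeff_msupp mcoeff_pihomog eb' eqxx top // -mcoeff_msupp.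
  move=> /gp /good_inv; rewrite mcons0 => /(_ k0) [_ [c gc]].
  by rewrite mtail_cons => /topD_inj ->.
move: mp; rewrite mcoeff_msupp mb -top //.
have := mcoeff_pihomog e (residue p) b; rewrite fe mcoeff0 eqxx => <-.
by rewrite eqxx.
Qed.

End LowerBound.

(** * Counting good monomials *)

Section Enumeration.
Variable F : finFieldType.
Local Notation q := #|F|.

(** The degree that [b] must have for the good monomial with quotient [b] and
    [x_0]-exponent [(q - 1) i] to have degree [d]. *)
Definition quot_deg n d i : option nat :=
  if (q.-1 * (i + n) <= d)%N && (q %| d - q.-1 * (i + n))%N
  then Some ((d - q.-1 * (i + n)) %/ q)%N else None.

Lemma quot_degP n d i e :
  quot_deg n d i = Some e <-> d = (q.-1 * i + (n * q.-1 + q * e))%N.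
Proof.
have q0 := card_gt0 F; rewrite /quot_deg; split=> [|->].
  case: ifP => // /andP[le /dvdnP[k ek]] [<-].
  by rewrite ek mulnK //; nia.
have -> : (q.-1 * i + (n * q.-1 + q * e) = q.-1 * (i + n) + q * e)%N by nia.
by rewrite leq_addr /= addnC addnK dvdn_mulr // mulKn.
Qed.

Fixpoint good_list n d : seq 'X_{1..n} :=
  match n with
  | 0 => if d == 0%N then [:: 0%MM] else [::]
  | n'.+1 => [seq mcons 0 m | m <- good_list n' d] ++
      [seq mcons (q.-1 * i) (topm F n' + b *+ q)%MM |
         i <- iota 1 d,
         b <- if quot_deg n' d i is Some e then good_list n' e else [::]]
  end.

Lemma mem_good_list n d m : (m \in good_list n d) = good F m && (mdeg m == d).
Proof.
elim: n d m => [|n IH] d m.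
  have -> : m = 0%MM by apply/mnmP => -[].
  by rewrite /= mdeg0 eq_sym; case: eqP => _; rewrite ?inE ?eqxx.
have q0 := predn_card_gt0 F.
rewrite mem_cat; apply/orP/andP => [[/mapP[m' + ->]|]|[gm /eqP dm]].
- by rewrite IH => /andP[gm' dm']; rewrite good_shift mdeg_cons add0n.
- case/allpairsPdep => i [b [+ + ->]]; rewrite mem_iota => /andP[i0 _].
  case E: (quot_deg n d i) => [e|] //; rewrite IH => /andP[gb /eqP db].
  move/quot_degP: E => ->; rewrite mdeg_cons mdeg_top db eqxx; split=> //.
  by apply: good_lead; rewrite ?muln_gt0 ?q0 ?dvdn_mulr.
have [m0|m0] := posnP (m ord0).
  left; apply/mapP; exists (mtail m); last by rewrite -m0 mcons_tail.
  rewrite IH -dm mdeg_tail m0 eqxx andbT.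
  by rewrite -good_shift -m0 mcons_tail.
have [/dvdnP[i mi] [b gb mb]] := good_inv gm m0.
right; apply/allpairsPdep; exists i, b; split.
- rewrite mem_iota add1n ltnS; apply/andP; split; first by case: i mi m0 => // ->.
  by rewrite -dm mdeg_tail mi; nia.
- have -> : quot_deg n d i = Some (mdeg b).
    by apply/quot_degP; rewrite -dm mdeg_tail mb mdeg_top mi mulnC.
  by rewrite IH gb eqxx.
by rewrite -mb mulnC -mi mcons_tail.
Qed.

Lemma mcons_inj n k k' (m m' : 'X_{1..n}) :
  mcons k m = mcons k' m' -> k = k' /\ m = m'.
Proof.
move=> e; split; first by rewrite -(mcons0 k m) e mcons0.
by rewrite -(mtail_cons k m) e mtail_cons.
Qed.

Lemma good_list_uniq n d : uniq (good_list n d).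
Proof.
elim: n d => [|n IH] d; first by rewrite /=; case: ifP.
have q0 := predn_card_gt0 F.
rewrite /= cat_uniq map_inj_uniq ?IH /=; last by move=> m m' /mcons_inj[].
apply/andP; split.
  apply/hasPn => m /allpairsPdep[i [b [+ _ ->]]].
  rewrite mem_iota => /andP[i0 _]; apply/mapP => -[m' _ /mcons_inj[e _]].
  by move: i0; rewrite lt0n -(eqn_pmul2l q0) e muln0 eqxx.
apply: allpairs_uniq_dep; first exact: iota_uniq.
  by move=> i _; case: (quot_deg n d i).
move=> [i b] [i' b'] _ _ /= /mcons_inj[ei eb].
have {}ei : i = i' by apply/eqP; rewrite -(eqn_pmul2l q0) ei.
by rewrite ei in b eb *; rewrite (topD_inj eb).
Qed.

Definition good_fps n : fps int := Fps (fun d => (size (good_list n d))%:Z).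

Definition dilate s (f : fps int) : fps int :=
  Fps (fun d => if (s %| d)%N then fps_coef f (d %/ s) else 0).

Lemma coef_dilate s f d :
  fps_coef (dilate s f) d = if (s %| d)%N then fps_coef f (d %/ s) else 0.
Proof. by []. Qed.

Lemma fps_coefXnM k (f : fps int) d : fps_coef (fpsX ^+ k * f) d =
  if (k <= d)%N then fps_coef f (d - k) else 0.
Proof.
rewrite fps_coefM; case: leqP => kd; last first.
  apply: big1 => i _; rewrite fps_coefXn.
  by rewrite (_ : (i : nat) == k = false) ?mul0r //; have := ltn_ord i; lia.
rewrite (bigD1 (Ordinal (kd : k < d.+1)%N)) //= fps_coefXn eqxx mul1r.
rewrite big1 ?addr0 // => i ik; rewrite fps_coefXn.
by rewrite (_ : (i : nat) == k = false) ?mul0r //; apply/negbTE.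
Qed.

Lemma dilateD s f g : dilate s (f + g) = dilate s f + dilate s g.
Proof. by apply/fpsP => d /=; case: ifP => _; rewrite ?addr0. Qed.

Lemma dilateN s f : dilate s (- f) = - dilate s f.
Proof. by apply/fpsP => d /=; case: ifP => _; rewrite ?oppr0. Qed.

Lemma dilateXnM s k f : (0 < s)%N ->
  dilate s (fpsX ^+ k * f) = fpsX ^+ (s * k) * dilate s f.
Proof.
move=> s0; apply/fpsP => d; rewrite fps_coefXnM !coef_dilate fps_coefXnM.
have [/dvdnP[e ->]|nd] := boolP (s %| d)%N.
  rewrite mulnK // mulnC leq_pmul2r // -mulnBl dvdn_mull // mulnK //.
have [le|//] := leqP (s * k) d; rewrite dvdn_subl ?dvdn_mulr //.
by rewrite (negPf nd).
Qed.

Lemma dilate_dilate s t f : (0 < s)%N -> (0 < t)%N ->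
  dilate s (dilate t f) = dilate (s * t) f.
Proof.
move=> s0 t0; apply/fpsP => d /=; have [/dvdnP[e ->]|nd] := boolP (s %| d)%N.
  by rewrite mulnK // [(s * t)%N]mulnC dvdn_pmul2r // divnMr.
by case: ifP => // /(dvdn_trans (dvdn_mulr t (dvdnn s))); rewrite (negPf nd).
Qed.

(** Dividing by [x_0^(q-1)] a good monomial that involves [x_0] gives either
    another such monomial or [x^(q-1,...,q-1)] times [x^(q b)] with [b] good. *)
Lemma good_fpsS n : (1 - fpsX ^+ q.-1) * (good_fps n.+1 - good_fps n) =
  fpsX ^+ (q.-1 * n.+1) * dilate q (good_fps n).
Proof.
have q0 := predn_card_gt0 F; have q1 := card_gt1 F.
(* The number of good monomials of degree [d] and [x_0]-exponent [(q - 1) i]. *)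
pose t d i : int := if (q.-1 * (i + n) <= d)%N then
  fps_coef (dilate q (good_fps n)) (d - q.-1 * (i + n)) else 0.
have E M d : (d <= M)%N -> fps_coef (good_fps n.+1 - good_fps n) d =
    \sum_(i < M) t d i.+1.
  move=> dM; have -> : fps_coef (good_fps n.+1 - good_fps n) d = \sum_(i < d) t d i.+1.
    rewrite fps_coefD fps_coefN /= size_cat size_map PoszD addrAC subrr add0r.
    have -> : iota 1 d = [seq i.+1 | i <- index_iota 0 d].
      by rewrite /index_iota subn0; apply: (iotaDl 1 0 d).
    rewrite size_allpairs_dep sumnE !big_map big_mkord.
    rewrite (big_morph Posz PoszD (erefl _)); apply: eq_bigr => i _.
    rewrite /t coef_dilate /quot_deg; case: (q.-1 * (i.+1 + n) <= d)%N => //=.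
    by case: ifP.
  rewrite (big_ord_widen M (fun i => t d i.+1) dM) big_mkcond /=.
  apply: eq_bigr => i _; case: ltnP => // di; rewrite /t ifN //.
  rewrite -ltnNge; apply: leq_ltn_trans di _.
  by apply: leq_trans (leq_pmull _ q0); apply: leq_addr.
apply/fpsP => d; rewrite mulrBl mul1r fps_coefD fps_coefN !fps_coefXnM.
rewrite (E d.+1) // big_ord_recl -/(t d 1%N).
have t1 : t d 1%N = if (q.-1 * n.+1 <= d)%N then
    fps_coef (dilate q (good_fps n)) (d - q.-1 * n.+1) else 0 by [].
rewrite t1 -addrA -[RHS]addr0; congr (_ + _).
case: leqP => dq; last first.
  rewrite subr0; apply: big1 => i _; rewrite /t ifN // -ltnNge.
  by apply: leq_trans dq _; apply: leq_pmulr; rewrite /bump addSn.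
rewrite (E d) ?leq_subr //; apply/eqP; rewrite subr_eq0; apply/eqP.
apply: eq_bigr => i _; rewrite /t /bump /=.
have -> : (q.-1 * ((1 + i).+1 + n) = q.-1 * (i.+1 + n) + q.-1)%N by nia.
by rewrite leq_subRL // addnC subnDA subnAC.
Qed.

(** The right-hand side of the theorem at [t^s]; the recursion in [n] replaces
    [t] by [t^q]. *)
Definition borel_fps n s : fps int :=
  \sum_(beta : {ffun 'I_n -> bool})
    fpsX ^+ (\sum_(i < n) s * (q ^ partial_sum beta i - 1))%N /
    \prod_(i < n | beta i)
      (1 - fpsX ^+ (s * (q ^ partial_sum beta i
                      - q ^ (partial_sum beta i - 1)))%N).

Definition fcons n (b : bool) (beta : {ffun 'I_n -> bool}) :
  {ffun 'I_n.+1 -> bool} := [ffun i => consf b beta i].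

Lemma partial_sum_cons0 n b (beta : {ffun 'I_n -> bool}) :
  partial_sum (fcons b beta) ord0 = b.
Proof.
by rewrite /partial_sum big_mkcond big_ord_recl /= ffunE consf0 big1 ?addn0.
Qed.

Lemma partial_sum_consS n b (beta : {ffun 'I_n -> bool}) i :
  partial_sum (fcons b beta) (lift ord0 i) = (b + partial_sum beta i)%N.
Proof.
rewrite /partial_sum big_mkcond big_ord_recl /= ffunE consf0; congr addn.
by rewrite [RHS]big_mkcond; apply: eq_bigr => j _; rewrite ffunE consfS.
Qed.

Lemma sum_fcons n (E : {ffun 'I_n.+1 -> bool} -> fps int) :
  \sum_beta E beta = \sum_beta E (fcons false beta) + \sum_beta E (fcons true beta).
Proof.
pose h (x : bool * {ffun 'I_n -> bool}) := fcons x.1 x.2.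
pose g (beta : {ffun 'I_n.+1 -> bool}) :=
  (beta ord0, [ffun j => beta (lift ord0 j)] : {ffun 'I_n -> bool}).
rewrite (reindex h) /=; last first.
  exists g => [[b beta] _|beta _].
    rewrite /g /h /= ffunE consf0; congr pair; apply/ffunP => j.
    by rewrite !ffunE consfS.
  apply/ffunP => i; rewrite /h /g /= ffunE; case: (unliftP ord0 i) => [j ->|->].
    by rewrite consfS ffunE.
  by rewrite consf0.
rewrite -(pair_bigA _ (fun b beta => E (fcons b beta))) /=.
by rewrite big_bool addrC.
Qed.

Lemma borel_fps0 s : borel_fps 0 s = 1.
Proof.
rewrite /borel_fps (big_pred1 [ffun=> false]) => [|beta]; last first.
  by apply/esym/eqP/ffunP => -[].
by rewrite !big_ord0 divr1 expr0.
Qed.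

Lemma partial_sum_gt0 n (beta : {ffun 'I_n -> bool}) i :
  beta i -> (0 < partial_sum beta i)%N.
Proof. by move=> bi; rewrite /partial_sum (bigD1 i) //= bi. Qed.

Lemma borel_fpsS n s : (0 < s)%N ->
  borel_fps n.+1 s = borel_fps n s +
    fpsX ^+ (s * (q.-1 * n.+1)) / (1 - fpsX ^+ (s * q.-1)) * borel_fps n (s * q).
Proof.
move=> s0; have q0 := predn_card_gt0 F; have q1 := card_gt1 F.
rewrite /borel_fps sum_fcons mulr_sumr; congr (_ + _).
  apply: eq_bigr => beta _; rewrite big_ord_recl partial_sum_cons0 muln0 add0n.
  congr (fpsX ^+ _ / _).
    by apply: eq_bigr => i _; rewrite partial_sum_consS.
  rewrite [LHS]big_mkcond big_ord_recl /= ffunE consf0 mul1r [RHS]big_mkcond.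
  by apply: eq_bigr => i _; rewrite ffunE consfS partial_sum_consS.
apply: eq_bigr => beta _.
have -> : (\sum_(i < n.+1) s * (q ^ partial_sum (fcons true beta) i - 1) =
    s * (q.-1 * n.+1) + \sum_(i < n) s * q * (q ^ partial_sum beta i - 1))%N.
  rewrite big_ord_recl partial_sum_cons0 expn1 subn1 mulnS mulnDr -addnA.
  congr addn; have -> : (s * (q.-1 * n) = \sum_(i < n) s * q.-1)%N.
    by rewrite sum_nat_const card_ord; nia.
  rewrite -big_split; apply: eq_bigr => i _ /=.
  rewrite partial_sum_consS expnD expn1 -mulnA -mulnDr; congr muln.
  have : (0 < q ^ partial_sum beta i)%N by rewrite expn_gt0 card_gt0.
  by nia.
have -> : \prod_(i < n.+1 | fcons true beta i) (1 - fpsX ^+ (s *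
    (q ^ partial_sum (fcons true beta) i - q ^ (partial_sum (fcons true beta) i - 1)))%N)
    = (1 - fpsX ^+ (s * q.-1)) * \prod_(i < n | beta i) (1 - fpsX ^+ (s * q *
    (q ^ partial_sum beta i - q ^ (partial_sum beta i - 1)))%N) :> fps int.
  rewrite big_mkcond big_ord_recl ffunE consf0 partial_sum_cons0.
  rewrite expn1 subnn expn0 subn1; congr (_ * _); rewrite [RHS]big_mkcond.
  apply: eq_bigr => i _; rewrite ffunE consfS; case: ifP => // bi.
  have B0 := partial_sum_gt0 bi; rewrite partial_sum_consS add1n subn1 /=.
  congr (1 - fpsX ^+ _); rewrite -mulnA; congr muln.
  by rewrite mulnBr -!expnS subn1 prednK.
rewrite exprD invrM; last 2 first.
- by rewrite fps_unit_1subXn // muln_gt0 s0.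
- apply: (big_ind (fun x => x \is a GRing.unit)) => [|x y ux uy|i bi].
  + exact: unitr1.
  + by rewrite unitrM ux.
  rewrite fps_unit_1subXn // !muln_gt0 s0 card_gt0 /= subn_gt0.
  by rewrite ltn_exp2l // subn1 ltn_predL partial_sum_gt0.
by rewrite [X in _ * _ * X]mulrC mulrACA.
Qed.

Theorem borel_fpsE n s : (0 < s)%N -> borel_fps n s = dilate s (good_fps n).
Proof.
elim: n s => [|n IH] s s0.
  rewrite borel_fps0; apply/fpsP => d; rewrite coef_dilate fps_coef1 /=.
  have [/dvdnP[e ->]|nd] := boolP (s %| d)%N.
    by rewrite mulnK // muln_eq0 orbC; case: s s0 => // s _ /=; case: eqP.
  by case: eqP => // d0; rewrite d0 dvdn0 in nd.
have q0 := predn_card_gt0 F.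
rewrite borel_fpsS // !IH ?muln_gt0 ?s0 ?card_gt0 //.
have u : 1 - fpsX ^+ (s * q.-1) \is a @GRing.unit (fps int).
  by rewrite fps_unit_1subXn // muln_gt0 s0.
have := good_fpsS n; set D := good_fps n.+1 - good_fps n => eD.
have -> : good_fps n.+1 = good_fps n + D by rewrite /D addrCA subrr addr0.
rewrite dilateD; congr (_ + _).
have := congr1 (dilate s) eD.
rewrite dilateXnM // dilate_dilate ?card_gt0 // mulrBl mul1r.
rewrite dilateD dilateN dilateXnM // -{1}[dilate s D]mul1r -mulrBl => e.
by rewrite mulrAC -e mulrC mulKr.
Qed.

End Enumeration.

(** * The Hilbert series *)

Section Assembly.
Variables (F : finFieldType) (n : nat).

Lemma uptri_GLval (g : {'GL_n.+1[F]}) : (g \in borel F n) = uptri (GLval g).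
Proof.
apply/borelP/uptriP => [u|[_ //]]; split=> // i.
have : \det (GLval g) != 0 by rewrite -unitfE -unitmxE; apply: (valP g).
rewrite -det_tr det_trig; last by apply/is_trig_mxP => a b ab; rewrite mxE u.
by move/prodf_neq0/(_ i isT); rewrite mxE.
Qed.

Lemma uptri_lift (s : 'M[F]_n.+1) : uptri s ->
  exists2 g : {'GL_n.+1[F]}, g \in borel F n & GLval g = s.
Proof.
move=> us; have [g gs] : exists g : {'GL_n.+1[F]}, GLval g = s.
  by exists (insubd (1%g : {'GL_n.+1[F]}) s); rewrite [LHS]insubdK // uptri_unit.
by exists g; rewrite // uptri_GLval gs.
Qed.

Variable d : nat.

Lemma mem_cofix_rel (v : dhomog n.+1 F d) :
  v \in cofix_rel (borel F n) d <-> rel d (v : {mpoly F[n.+1]}).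
Proof.
split=> [/memv_sumP[w wB ->]|].
  rewrite (linear_sum (@mpoly_of_dhomog _ _ _)); apply: rel_sum => g gB.
  have /memv_imgP[u _ ->] := wB g gB; rewrite lfunE.
  by apply: rel_act; [rewrite -uptri_GLval | apply: dhomog_is_dhomog].
suff H p : rel d p -> exists2 u : dhomog n.+1 F d,
    u \in cofix_rel (borel F n) d & p = u :> {mpoly F[n.+1]}.
  by move=> /H[u uR vu]; rewrite (_ : v = u) //; apply: val_inj.
elim=> [|r s f _ [u uR ->] us fd]; first by exists 0; rewrite ?mem0v.
have [g gB gs] := uptri_lift us.
exists (u + dhomog_actB (GLval g) (DHomog fd)); last by rewrite -gs.
apply: memvD uR _; apply: (subvP (sumv_sup g gB (subvv _))).
by apply/memv_imgP; exists (DHomog fd); rewrite ?memvf // lfunE.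
Qed.

Definition monom (m : 'X_{1..n.+1}) : dhomog n.+1 F d :=
  DHomog (pihomogP mdeg d 'X_[m]).

Lemma monomE m : mdeg m = d -> monom m = 'X_[m] :> {mpoly F[n.+1]}.
Proof. by move=> dm; apply: pihomog_dE; rewrite dhomogX /= dm. Qed.

Local Notation gs := (good_list F n.+1 d).

Definition good_basis : (size gs).-tuple (dhomog n.+1 F d) :=
  [tuple monom (nth 0%MM gs i) | i < size gs].

Lemma sum_good_basis (k : 'I_(size gs) -> F) :
  (\sum_i k i *: good_basis`_i) =
  \sum_i k i *: 'X_[nth 0%MM gs i] :> {mpoly F[n.+1]}.
Proof.
rewrite (linear_sum (@mpoly_of_dhomog _ _ _)); apply: eq_bigr => i _.
rewrite -tnth_nth tnth_mktuple [LHS]linearZ; congr (_ *: _).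
apply: monomE; by have := mem_nth 0%MM (ltn_ord i); rewrite mem_good_list => /andP[_ /eqP].
Qed.

Lemma good_basis_free : free good_basis.
Proof.
apply/freeP => k kE i; have := sum_good_basis k; rewrite kE.
move/(congr1 (mcoeff (nth 0%MM gs i))); rewrite mcoeff0 raddf_sum /=.
rewrite (bigD1 i) //= mcoeffZ mcoeffX eqxx mulr1 big1 ?addr0 // => j ji.
rewrite mcoeffZ mcoeffX nth_uniq ?good_list_uniq // ?ltn_ord //.
by rewrite val_eqE (negPf ji) mulr0.
Qed.

Lemma good_basis_msupp u : u \in <<good_basis>>%VS ->
  {subset msupp (u : {mpoly F[n.+1]}) <= @good F n.+1}.
Proof.
move=> /coord_span -> m; rewrite mcoeff_msupp sum_good_basis raddf_sum /=.
apply: contraR => gm; apply/eqP/big1 => i _; rewrite mcoeffZ mcoeffX.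
case: eqP => [e|_]; last by rewrite mulr0.
have := mem_nth 0%MM (ltn_ord i); rewrite e mem_good_list => /andP[gm' _].
by case/negP: gm.
Qed.

Lemma mem_good_basis (u : dhomog n.+1 F d) :
  {subset msupp (u : {mpoly F[n.+1]}) <= @good F n.+1} ->
  u \in <<good_basis>>%VS.
Proof.
move=> gu; have hu := dhomog_is_dhomog u.
have -> : u = \sum_(m <- msupp (u : {mpoly F[n.+1]})) (u : {mpoly F[n.+1]})@_m *: monom m.
  apply: val_inj; rewrite /= (linear_sum (@mpoly_of_dhomog _ _ _)) {1}[val u]mpolyE.
  rewrite big_seq [RHS]big_seq; apply: eq_bigr => m mu.
  by rewrite [RHS]linearZ; congr (_ *: _); rewrite [RHS]monomE ?(dhomog_mf hu mu).
rewrite big_seq; apply: memv_suml => m mu; apply/memvZ/memv_span.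
have mg : m \in gs.
  by rewrite mem_good_list (dhomog_mf hu mu) eqxx andbT; apply: gu.
apply/tnthP; rewrite -index_mem in mg; exists (Ordinal mg).
by rewrite tnth_mktuple nth_index // -index_mem.
Qed.

Lemma cofix_dimE : cofix_dim (borel F n) d = size gs.
Proof.
rewrite /cofix_dim; set R := cofix_rel _ _; set U := <<good_basis>>%VS.
have dU : \dim U = size gs.
  by move/eqP: good_basis_free; rewrite size_tuple.
have RU0 : (R :&: U = 0)%VS.
  apply/eqP; rewrite -subv0; apply/subvP => u; rewrite memv_cap memv0.
  case/andP => /mem_cofix_rel ru uU; apply/eqP/val_inj.
  exact: good_free ru (good_basis_msupp uU).
have RUT : (R + U = fullv)%VS.
  apply/eqP; rewrite eqEsubv subvf; apply/subvP => u _.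
  have [w [gw rw]] := good_span (dhomog_is_dhomog u).
  have wd : w \is d.-homog.
    rewrite -[w](subKr (u : {mpoly F[n.+1]})).
    by rewrite rpredB ?dhomog_is_dhomog // (rel_homog rw).
  rewrite (_ : u = (u - DHomog wd) + DHomog wd); last by rewrite subrK.
  apply: memv_add; last exact: mem_good_basis.
  exact/mem_cofix_rel.
by rewrite -RUT dimv_disjoint_sum // dU addKn.
Qed.

End Assembly.

Theorem corollary1p8 (q : nat) (F : finFieldType) (hq : #|F| = q) (n : nat) :
  cofix_hilbert (borel F n) =
    \sum_(beta : {ffun 'I_n.+1 -> bool})
      fpsX ^+ (\sum_(i < n.+1) (q ^ partial_sum beta i - 1))%N /
      \prod_(i < n.+1 | beta i)
        (1 - fpsX ^+ (q ^ partial_sum beta i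
                      - q ^ (partial_sum beta i - 1))%N).
Proof.
have -> : cofix_hilbert (borel F n) = borel_fps F n.+1 1.
  rewrite borel_fpsE //; apply/fpsP => d.
  by rewrite coef_dilate dvd1n divn1 /= cofix_dimE.
rewrite /borel_fps hq; apply: eq_bigr => beta _; congr (fpsX ^+ _ / _).
  by apply: eq_bigr => i _; rewrite mul1n.
by apply: eq_bigr => i _; rewrite mul1n.
Qed.
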